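(* For all integers $n,k\ge 3$, the quadrangulation $Q_{n,k}$ of the $2$-torus is realizable as a noble toroidal $2$-polyhedron in $\mathbb{R}^4$, and for every integer $n\ge 3$, $Q_{n,n}$ is realizable as a regular toroidal $2$-polyhedron in $\mathbb{R}^4$.
   Context: $C_n$ is the simple cycle graph of length $n$, with vertices labelled by $\mathbb{Z}/n$ and edges $\{i,i+1\}$. The Cartesian product $C_n\times C_k$ has vertex set $\mathbb{Z}/n\times\mathbb{Z}/k$, with two vertices adjacent iff they agree in one coordinate and are adjacent in the cycle corresponding to the other coordinate. $Q_{n,k}$ is the quadrangulation of the $2$-torus obtained from the natural embedding of $C_n\times C_k$ in the torus as $n$ parallels and $k$ meridians (or vice versa). As an abstract $2$-complex its vertices and edges are those of $C_n\times C_k$, and its $nk$ faces are the quadrilaterals with consecutive vertices $(i,j),(i+1,j),(i+1,j+1),(i,j+1)$. An automorphism of a complex is a bijection of its vertex set to itself that maps the vertex set of each cell to the vertex set of a cell; $\mathrm{Aut}(K)$ is the automorphism group of $K$. A flag of a $2$-complex is a triple (vertex, edge, face) of pairwise incident elements. A geometric realization in $\mathbb{R}^d$ of an abstract $2$-complex $K$ is a $2$-polyhedron in $\mathbb{R}^d$ whose cell structure is inherited from $K$ and whose corner points correspond bijectively to the vertices of $K$. It is without hidden symmetries if each automorphism of $K$ is induced by a Euclidean symmetry (an isometry of $\mathbb{R}^d$ leaving the polyhedron invariant) of the realization. A geometric realization without hidden symmetries, in $\mathbb{R}^d$, of a polygonization $K$ of a closed $2$-manifold is called a regular $2$-polyhedron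 if $\mathrm{Aut}(K)$ is flag-transitive, and a noble $2$-polyhedron if $\mathrm{Aut}(K)$ is vertex-transitive and face-transitive (but not necessarily edge-transitive). It is toroidal if the manifold is the $2$-torus. *)

(* Defs.v *)
From mathcomp Require Import all_boot all_order all_algebra all_fingroup.
From mathcomp Require Import all_classical all_reals all_analysis.

Set Implicit Arguments.
Unset Strict Implicit.
Unset Printing Implicit Defensive.

Import Order.TTheory GRing.Theory Num.Theory.
Import numFieldNormedType.Exports.

Local Open Scope ring_scope.

Section AbstractComplexes.

(* E is the edge set of a cycle graph of length at least 3 with vertex set S. *)
Definition is_cycle (T : finType) (S : {set T}) (E : {set {set T}}) : Prop :=
  exists s : seq T, [/\ (3 <= size s)%N, uniq s, S = finset (mem s) &
    E = [set [set x; next s x] | x in s]%SET].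

(* Cells are represented by their vertex sets; the 0-cells are the singletons. *)
Record complex (V : finType) := Complex {
  edges : {set {set V}};
  faces : {set {set V}}
}.

Variable V : finType.
Implicit Types (K : complex V) (v : V) (e F : {set V}).

Definition cells K : {set {set V}} :=
  ([set [set v] | v : V] :|: edges K :|: faces K)%SET.

(* Edges have two ends and the edges contained in a face form a cycle through
   all the vertices of that face; so incidence of cells is inclusion. *)
Definition polygonal K : Prop :=
  (forall e, e \in edges K -> #|e| = 2%N) /\
  (forall F, F \in faces K ->
     is_cycle F [set e in edges K | e \subset F]%SET).

Definition edges_at K v : {set {set V}} := [set e in edges K | v \in e]%SET.

(* The edges of the link of v: each face at v joins the edges it contains
   among those at v. *)
Definition link_edges K v : {set {set {set V}}} :=
  [set [set e in edges_at K v | e \subset F] | F : {set V} in faces K & v \in F]%SET.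

(* Polygonization of a closed (connected) 2-manifold. *)
Definition polygonized_closed_surface K : Prop :=
  [/\ polygonal K,
      forall e, e \in edges K -> #|[set F in faces K | e \subset F]%SET| = 2%N,
      forall v, is_cycle (edges_at K v) (link_edges K v) &
      forall u v, connect (fun x y : V => [set x; y]%SET \in edges K) u v].

Definition complex_aut K : {set {perm V}} :=
  [set s : {perm V} | [forall c in cells K, (s @: c)%SET \in cells K]]%SET.

Lemma complex_aut_group_set K : group_set (complex_aut K).
Proof.
apply/group_setP; split=> [|s t].
  rewrite inE; apply/forall_inP => c cK.
  by rewrite (eq_imset c (@perm1 V)) imset_id.
rewrite !inE => /forall_inP sK /forall_inP tK; apply/forall_inP => c cK.
by rewrite (eq_imset c (permM s t)) imset_comp tK ?sK.
Qed.

Canonical complex_aut_group K := Group (complex_aut_group_set K).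

Definition flag K (v : V) e F : bool :=
  [&& v \in e, v \in F, e \subset F, e \in edges K & F \in faces K].

Definition vertex_transitive K : bool :=
  [transitive complex_aut K, on [set: V]%SET | 'P].

Definition face_transitive K : bool :=
  [transitive complex_aut K, on faces K | 'P^*].

Definition flag_transitive K : Prop :=
  forall v e F v' e' F', flag K v e F -> flag K v' e' F' ->
  exists2 s : {perm V}, s \in complex_aut K &
    [/\ s v = v', (s @: e)%SET = e' & (s @: F)%SET = F'].

End AbstractComplexes.

Section TorusQuadrangulation.

Definition cycle_adj (n : nat) : rel 'Z_n :=
  fun i j => (j == i + 1) || (i == j + 1).

Definition cartesian_adj (T1 T2 : eqType) (r1 : rel T1) (r2 : rel T2)
  : rel (T1 * T2) :=
  fun x y => (x.1 == y.1) && r2 x.2 y.2 || (x.2 == y.2) && r1 x.1 y.1.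

(* As 'Z_n is Z/n only for n > 1, these are meant for n, k >= 3. *)
Definition torus_quad (n k : nat) : complex ('Z_n * 'Z_k)%type :=
  Complex
    [set e : {set 'Z_n * 'Z_k} | [exists x, [exists y,
       cartesian_adj (@cycle_adj n) (@cycle_adj k) x y && (e == [set x; y])]]]%SET
    [set [set p; (p.1 + 1, p.2); (p.1 + 1, p.2 + 1); (p.1, p.2 + 1)]
       | p : 'Z_n * 'Z_k]%SET.

End TorusQuadrangulation.

Local Open Scope classical_set_scope.

Section Polyhedra.
Variable R : realType.

(* The topology of 'rV[R]_d is that of the sup norm, i.e. the Euclidean one,
   but isometries have to refer to the Euclidean distance. *)
Definition euclidean_dist (d : nat) (x y : 'rV[R]_d) : R :=
  Num.sqrt (\sum_(i < d) (x 0 i - y 0 i) ^+ 2).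

Definition euclidean_isometry (d : nat) (T : 'rV[R]_d -> 'rV[R]_d) : Prop :=
  forall x y, euclidean_dist (T x) (T y) = euclidean_dist x y.

Definition homeomorphic (X Y : topologicalType) (A : set X) (B : set Y) : Prop :=
  exists (g : X -> Y) (h : Y -> X),
    [/\ {within A, continuous g}, {within B, continuous h},
        g @` A `<=` B, h @` B `<=` A &
        {in A, cancel g h} /\ {in B, cancel h g}].

Definition circle : set (R * R) := [set x | x.1 ^+ 2 + x.2 ^+ 2 = 1].

Definition torus : set ((R * R) * (R * R)) := circle `*` circle.

Variables (V : finType) (d : nat).
Implicit Types (K : complex V) (f : V -> 'rV[R]_d) (c e F : {set V}).

Definition hull f c : set 'rV[R]_d :=
  [set x | exists w : V -> R, [/\ forall v, v \in c -> 0 <= w v,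
     \sum_(v in c) w v = 1 & x = \sum_(v in c) w v *: f v]].

Definition polyhedron K f : set 'rV[R]_d :=
  \bigcup_(c in [set` cells K]) hull f c.

Definition coplanar f F : Prop :=
  exists (p : 'rV[R]_d) (B : 'M[R]_(2, d)), row_free B /\
    forall v, v \in F -> (f v - p <= B)%MS.

(* e spans a side of the convex polygon with corners f v, v in F: it is cut out
   by a supporting hyperplane. *)
Definition side_of f e F : Prop :=
  exists (a : 'cV[R]_d) (b : R),
    (forall v, v \in e -> (f v *m a) 0 0 = b) /\
    (forall v, v \in F -> v \notin e -> (f v *m a) 0 0 < b).

(* The cells are spanned by the images of the vertices: faces are planar convex
   polygons whose sides are the edges prescribed by K, and two cells meet
   exactly in the cells they share (no self-intersection). *)
Record geometric_realization K f : Prop := {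
  realization_inj : injective f;
  realization_planar : forall F, F \in faces K -> coplanar f F;
  realization_sides : forall e F, e \in edges K -> F \in faces K ->
    e \subset F -> side_of f e F;
  realization_meet : forall c1 c2, c1 \in cells K -> c2 \in cells K ->
    hull f c1 `&` hull f c2 `<=`
    \bigcup_(c in [set c | [/\ c \in cells K, c \subset c1 & c \subset c2]])
      hull f c
}.

Definition without_hidden_symmetries K f : Prop :=
  forall s : {perm V}, s \in complex_aut K ->
  exists T : 'rV[R]_d -> 'rV[R]_d,
    [/\ euclidean_isometry T, T @` polyhedron K f = polyhedron K f &
        forall v, T (f v) = f (s v)].

Record regular_polyhedron K f : Prop := {
  regular_surface : polygonized_closed_surface K;
  regular_realization : geometric_realization K f;
  regular_symmetries : without_hidden_symmetries K f;
  regular_flags : flag_transitive K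
}.

Record noble_polyhedron K f : Prop := {
  noble_surface : polygonized_closed_surface K;
  noble_realization : geometric_realization K f;
  noble_symmetries : without_hidden_symmetries K f;
  noble_vertices : vertex_transitive K;
  noble_faces : face_transitive K
}.

Definition toroidal K f : Prop := homeomorphic (polyhedron K f) torus.

End Polyhedra.

(* Main.v *)
Require Import Defs.
From mathcomp Require Import all_boot all_order all_algebra all_fingroup.

Set Implicit Arguments.
Unset Strict Implicit.
Unset Printing Implicit Defensive.

Import GRing.Theory.

(** The torus is a product of two circles, and Q_{n,k} is the product of the two
    cycle graphs drawn on them.  Put the vertices of the first cycle at the
    corners of a regular n-gon in one plane and those of the second at the
    corners of a regular k-gon in a plane orthogonal to the first.  The product
    of the two boundary polygons is then a polyhedral torus in 4-space (part of
    the 2-skeleton of a duoprism) whose faces are rectangles.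

    A cell of Q_{n,k} is a product of two arcs, an arc being a vertex or an edge
    of a cycle.  Each arc of a regular polygon is cut out by a supporting line
    ([arc_exposed]); adding the two linear forms shows that each cell is cut out
    from the set of all vertices by a supporting hyperplane ([cell_exposed]).
    This gives both the sides of the faces and the absence of
    self-intersections, because a point in the hull of a set of vertices and in
    an exposed cell is in the hull of their intersection ([exposed_hullI]).

    There are no hidden symmetries because there are few automorphisms.  Around
    a vertex an automorphism permutes the four neighbours, and it respects which
    pairs of them lie in a common face; so it sends opposite neighbours to
    opposite neighbours, hence straight lines to straight lines, and is affine
    ([aut_affine]): up to a translation it changes signs and perhaps swaps the
    two coordinates, the latter only if n = k.  Rotations and reflections of the
    two polygons, and the exchange of the two planes, realize all these maps
    ([duoprism_symmetries]).  The same maps make the automorphism group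
    transitive on vertices and faces, and on flags if n = k.

    The boundary of a regular polygon is the level set 1 of its gauge, a maximum
    of finitely many linear forms ([gauge_boundary]), so division by the norm and
    division by the gauge are inverse homeomorphisms between the polygon and the
    circle; their products identify the polyhedron with the torus
    ([duoprism_toroidal]). *)

Local Open Scope ring_scope.

(** * Arcs of a cycle and products of arcs *)

Section CycleArcs.
Local Open Scope set_scope.
Variable n : nat.
Hypothesis n_gt2 : (2 < n)%N.
Implicit Types (i j : 'Z_n) (a b : bool).

(** Together with 1 != 0 this is all that the local structure of a cycle of
    length at least 3 depends on: i - 1, i and i + 1 are distinct. *)
Lemma Zp_two_neq0 : (1 + 1 : 'Z_n) != 0.
Proof.
have : (2%:R : 'Z_n) != 0; last by [].
apply/eqP => /(congr1 (@nat_of_ord _)).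
by rewrite val_Zp_nat 1?ltnW // modn_small.
Qed.

Lemma succ_eq i : (i + 1 == i) = false.
Proof. by rewrite -[X in _ == X]addr0 (inj_eq (addrI i)) oner_eq0. Qed.

Lemma succ2_eq i : (i + 1 + 1 == i) = false.
Proof. by rewrite -addrA -[X in _ == X]addr0 (inj_eq (addrI i)) (negPf Zp_two_neq0). Qed.

Lemma pred_eq i : (i == i - 1) = false.
Proof. by rewrite eq_sym subr_eq eq_sym succ_eq. Qed.

Definition succE := (succ_eq, succ2_eq, fun i => etrans (eq_sym _ _) (succ_eq i),
  fun i => etrans (eq_sym _ _) (succ2_eq i)).

(** Vertices (a = false) and edges (a = true) of the cycle are treated uniformly,
    so that the cells of the torus of all dimensions are the products of arcs. *)
Definition arc a i : {set 'Z_n} := if a then [set i; i + 1] else [set i].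

Lemma in_arc a i j : (j \in arc a i) = (j == i) || a && (j == i + 1).
Proof. by case: a; rewrite !inE ?orbF. Qed.

Lemma arc_id a i : i \in arc a i.
Proof. by rewrite in_arc eqxx. Qed.

Lemma card_arc a i : #|arc a i| = a.+1.
Proof. by case: a; rewrite ?cards1 // cards2 succE. Qed.

Lemma arc_sub a i b j :
  (arc a i \subset arc b j) = (i == j) && (a ==> b) || [&& ~~ a, b & i == j + 1].
Proof.
case: a; rewrite {1}/arc ?subUset !sub1set !in_arc /= ?andbT //.
rewrite orbF (can_eq (addrK _)).
have [->|_] := eqVneq i j; first by rewrite !succE; case: b.
by case: b => //=; apply/negP => /andP[/eqP-> /=]; rewrite succE.
Qed.

Lemma arc_inj a i b j : arc a i = arc b j -> a = b /\ i = j.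
Proof.
move=> E; have := congr1 (fun A : {set _} => #|A|) E; rewrite /= !card_arc => -[ab].
have {}ab : a = b by case: a b ab {E} => [] [].
move: E; rewrite {}ab => /eqP; rewrite eqEsubset !arc_sub.
by case: b => /= /andP[]; rewrite ?andbT ?andbF ?orbF => /eqP-> .
Qed.

(** Two arcs meet in an arc: the intersection is one of them or, being a proper
    part of a set with at most two elements, a single vertex. *)
Lemma arcI a i b j x : x \in arc a i -> x \in arc b j ->
  exists c l, arc a i :&: arc b j = arc c l.
Proof.
have [ab _ _|nab xa xb] := boolP (arc a i \subset arc b j).
  by exists a, i; apply/setIidPl.
have pr : arc a i :&: arc b j \proper arc a i.
  by rewrite properE subsetIl subsetI subxx.
exists false, x; apply/eqP; rewrite eq_sym eqEcard sub1set inE xa xb cards1 /=.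
rewrite -ltnS (leq_trans (proper_card pr))// card_arc.
by case: (a).
Qed.

End CycleArcs.

Section SetLemmas.
Local Open Scope set_scope.

Lemma setX_sub (T1 T2 : finType) (A C : {set T1}) (B D : {set T2}) x y :
  x \in A -> y \in B ->
  (setX A B \subset setX C D) = (A \subset C) && (B \subset D).
Proof.
move=> xA yB; apply/idP/andP => [/subsetP AB|[AC BD]]; last exact: setXS.
split; apply/subsetP => z zz.
  by have := AB (z, y); rewrite !in_setX zz yB => /(_ isT) /andP[].
by have := AB (x, z); rewrite !in_setX zz xA => /(_ isT) /andP[].
Qed.

Lemma imset_setX (T1 T2 S1 S2 : finType) (f : T1 -> S1) (g : T2 -> S2)
    (A : {set T1}) (B : {set T2}) :
  [set (f p.1, g p.2) | p in setX A B] = setX (f @: A) (g @: B).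
Proof.
apply/setP => -[y z]; rewrite in_setX.
apply/imsetP/andP => [[[p q] /setXP[pA qB] [-> ->]]|].
  by rewrite !imset_f.
by case=> /imsetP[p pA ->] /imsetP[q qB ->]; exists (p, q); rewrite ?in_setX ?pA.
Qed.

Lemma imset_set4 (T S : finType) (f : T -> S) (x y z t : T) :
  f @: [set x; y; z; t] = [set f x; f y; f z; f t].
Proof. by rewrite !imsetU !imset_set1. Qed.

Lemma is_cycle4 (T : finType) (x y z t : T) : uniq [:: x; y; z; t] ->
  is_cycle [set x; y; z; t]
    [set [set x; y]; [set y; z]; [set z; t]; [set t; x]].
Proof.
move=> u; exists [:: x; y; z; t]; split=> //.
  by apply/setP => v; rewrite !inE -!orbA.
rewrite (_ : imset _ _ = [set [set v; next [:: x; y; z; t] v] | v in [set x; y; z; t]]).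
  move: u; rewrite imset_set4 /= !inE !negb_or.
  case/and4P=> /and3P[xy xz xt] /andP[yz yt] zt _.
  rewrite !eqxx ?(eq_sym y x) ?(eq_sym z x) ?(eq_sym t x) ?(eq_sym z y).
  rewrite ?(eq_sym t y) ?(eq_sym t z) ?(negPf xy) ?(negPf xz) ?(negPf xt).
  by rewrite ?(negPf yz) ?(negPf yt) ?(negPf zt).
apply/setP => e.
by apply/imsetP/imsetP => -[v vs ->]; exists v; rewrite // !inE -?orbA in vs *.
Qed.

End SetLemmas.

Section TorusComplex.
Local Open Scope set_scope.
Variables n k : nat.
Hypotheses (n_gt2 : (2 < n)%N) (k_gt2 : (2 < k)%N).
Local Notation V := ('Z_n * 'Z_k)%type.
Local Notation K := (torus_quad n k).
Implicit Types (p q u v x y : V) (i : 'Z_n) (j : 'Z_k) (a b : bool).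

Definition box a i b j : {set V} := setX (arc a i) (arc b j).

Lemma box_sub a i b j a' i' b' j' : (box a i b j \subset box a' i' b' j') =
  (arc a i \subset arc a' i') && (arc b j \subset arc b' j').
Proof. exact: setX_sub (arc_id _ _) (arc_id _ _). Qed.

Lemma box_inj a i b j a' i' b' j' : box a i b j = box a' i' b' j' ->
  [/\ a = a', i = i', b = b' & j = j'].
Proof.
move/eqP; rewrite eqEsubset !box_sub => /andP[/andP[A1 B1] /andP[A2 B2]].
have /(arc_inj n_gt2)[-> ->] : arc a i = arc a' i' by apply/eqP; rewrite eqEsubset A1.
by have /(arc_inj k_gt2)[-> ->] : arc b j = arc b' j' by apply/eqP; rewrite eqEsubset B1.
Qed.

Lemma in_box a i b j p : (p \in box a i b j) = (p.1 \in arc a i) && (p.2 \in arc b j).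
Proof. by rewrite {1}[p]surjective_pairing in_setX. Qed.

Lemma card_box a i b j : #|box a i b j| = (a.+1 * b.+1)%N.
Proof. by rewrite cardsX !card_arc. Qed.

Lemma box_h i j : box true i false j = [set (i, j); (i + 1, j)].
Proof. by apply/setP=> -[x y]; rewrite in_box !inE !xpair_eqE /= -andb_orl. Qed.

Lemma box_v i j : box false i true j = [set (i, j); (i, j + 1)].
Proof. by apply/setP=> -[x y]; rewrite in_box !inE !xpair_eqE /= -andb_orr. Qed.

Lemma box_hv i j :
  box true i true j = [set (i, j); (i + 1, j); (i + 1, j + 1); (i, j + 1)].
Proof.
apply/setP=> -[x y]; rewrite in_box !inE !xpair_eqE /=.
by do 4 case: (_ == _).
Qed.

(** The differences between neighbours in the product of the two cycles. *)
Definition steps : seq V := [:: (1, 0); (-1, 0); (0, 1); (0, -1)].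

Lemma addVE u v : u + v = (u.1 + v.1, u.2 + v.2). Proof. by []. Qed.

Lemma uniq_steps : uniq steps.
Proof.
rewrite /= !inE !xpair_eqE !(eq_sym 0) !oppr_eq0 !oner_eq0 /=.
by rewrite -!addr_eq0 (negPf (Zp_two_neq0 n_gt2)) (negPf (Zp_two_neq0 k_gt2)).
Qed.

Lemma stepN x : (- x \in steps) = (x \in steps).
Proof.
have H y : y \in steps -> - y \in steps.
  by rewrite !inE => /or4P[] /eqP->; rewrite !xpair_eqE /= ?opprK ?oppr0 !eqxx ?orbT.
by apply/idP/idP => [/H|/H //]; rewrite opprK.
Qed.

Lemma step_neqN x : x \in steps -> - x != x.
Proof.
have n2 := Zp_two_neq0 n_gt2; have k2 := Zp_two_neq0 k_gt2.
rewrite eq_sym -addr_eq0 !inE => /or4P[] /eqP->; rewrite !xpair_eqE /=.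
all: by rewrite -?opprD ?oppr_eq0 ?(negPf n2) ?(negPf k2) ?andbF.
Qed.

Lemma step0 : (0 : V) \notin steps.
Proof. by rewrite !inE !xpair_eqE /= !(eq_sym 0) !oppr_eq0 !oner_eq0. Qed.

Lemma adj_step x y : cartesian_adj (@cycle_adj n) (@cycle_adj k) x y =
  (y - x \in steps).
Proof.
case: x y => [x x'] [y y']; rewrite /cartesian_adj /cycle_adj /= !inE !xpair_eqE /=.
have E (m : nat) (z t : 'Z_m) : (z - t == 0) = (t == z) by rewrite subr_eq0 eq_sym.
have E1 (m : nat) (z t : 'Z_m) : (z - t == 1) = (z == t + 1) by rewrite subr_eq addrC.
have E2 (m : nat) (z t : 'Z_m) : (z - t == -1) = (t == z + 1).
  by rewrite -(inj_eq oppr_inj) opprB opprK E1.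
rewrite !E !E1 !E2; by do ! case: (_ == _).
Qed.

Lemma edge_step x y : ([set x; y] \in edges K) = (y - x \in steps).
Proof.
rewrite inE; apply/existsP/idP => [[x' /existsP[y' /andP[]]]|yx]; last first.
  by exists x; apply/existsP; exists y; rewrite adj_step yx eqxx.
rewrite adj_step => yx' /eqP E.
have ne : x' != y' by apply: contraTneq yx' => ->; rewrite subrr step0.
have /set2P Ex : x' \in [set x; y] by rewrite E set21.
have /set2P Ey : y' \in [set x; y] by rewrite E set22.
by case: Ex Ey ne yx' => [] -> [] ->; rewrite ?eqxx // -opprB stepN.
Qed.

Lemma edgeP e : reflect (exists a i j, e = box a i (~~ a) j) (e \in edges K).
Proof.
apply: (iffP idP) => [|[a [i [j ->]]]]; last first.
  case: a; rewrite ?box_h ?box_v edge_step; apply/or4P;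
  by rewrite !xpair_eqE /= !subrr !(addrC _ 1) !addrK !eqxx; constructor.
rewrite inE => /existsP[[x x'] /existsP[[y y'] /andP[]]].
rewrite adj_step !inE => /or4P[]; rewrite subr_eq => /eqP-> /eqP->.
- by exists true, x, x'; rewrite box_h addVE /= add0r addrC.
- exists true, (x - 1), x'.
  by rewrite box_h addVE /= setUC subrK add0r [_ + x]addrC.
- by exists false, x, x'; rewrite box_v addVE /= add0r [_ + x']addrC.
- exists false, x, (x' - 1).
  by rewrite box_v addVE /= setUC subrK add0r [_ + x']addrC.
Qed.

Lemma faceP F : reflect (exists i j, F = box true i true j) (F \in faces K).
Proof.
apply: (iffP imsetP) => [[[i j] _ ->]|[i [j ->]]].
  by exists i, j; rewrite box_hv.
by exists (i, j); rewrite ?box_hv.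
Qed.

Lemma edge_box a i b j : (box a i b j \in edges K) = a (+) b.
Proof.
apply/edgeP/idP => [[a' [i' [j' /box_inj[-> _ -> _]]]]|]; first by case: a'.
by case: a; case: b => // _; [exists true|exists false]; exists i, j.
Qed.

Lemma face_box a i b j : (box a i b j \in faces K) = a && b.
Proof.
apply/faceP/idP => [[i' [j' /box_inj[-> _ -> _]]] //|/andP[]].
by case: a; case: b => // _ _; exists i, j.
Qed.

Lemma cellP c : reflect (exists a i b j, c = box a i b j) (c \in cells K).
Proof.
have B0 i j : box false i false j = [set (i, j)].
  by apply/setP => -[x y]; rewrite in_box !inE.
apply: (iffP idP) => [|[a [i [b [j ->]]]]]; rewrite !in_setU.
  case/orP=> [/orP[/imsetP[[i j] _ ->]|/edgeP[a [i [j ->]]]]|/faceP[i [j ->]]].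
  - by exists false, i, false, j.
  - by exists a, i, (~~ a), j.
  - by exists true, i, true, j.
case: a; case: b.
- by apply/orP; right; apply/faceP; exists i, j.
- by apply/orP; left; apply/orP; right; apply/edgeP; exists true, i, j.
- by apply/orP; left; apply/orP; right; apply/edgeP; exists false, i, j.
- by apply/orP; left; apply/orP; left; rewrite B0 imset_f.
Qed.

(** Vertices, edges and faces have 1, 2 and 4 elements, so a permutation that
    preserves the set of all cells preserves the edges and the faces. *)
Lemma cell_edge c : c \in cells K -> #|c| = 2 -> c \in edges K.
Proof.
case/cellP=> a [i [b [j ->]]]; rewrite card_box => ab; apply/edgeP.
by exists a, i, j; case: a b ab => [] [].
Qed.

Lemma cell_face c : c \in cells K -> #|c| = 4 -> c \in faces K.
Proof.
case/cellP=> a [i [b [j ->]]]; rewrite card_box => ab; apply/faceP.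
by exists i, j; case: a b ab => [] [].
Qed.

(** A nonempty intersection of cells is a cell, coordinatewise by [arcI]. *)
Lemma cellI c c' p : c \in cells K -> c' \in cells K -> p \in c -> p \in c' ->
  c :&: c' \in cells K.
Proof.
case/cellP=> a [i [b [j ->]]] /cellP[a' [i' [b' [j' ->]]]].
rewrite !in_box => /andP[p1 p2] /andP[q1 q2].
have [d [l E]] := arcI p1 q1; have [d' [l' E']] := arcI p2 q2.
apply/cellP; exists d, l, d', l'; apply/setP => x.
by rewrite in_setI !in_box -E -E' !inE andbACA.
Qed.

(** * The complex is a closed surface *)

Lemma polygonal_torus : polygonal K.
Proof.
split=> [e /edgeP[a [i [j ->]]]|F /faceP[i [j ->]]].
  by rewrite card_box; case: a.
rewrite (_ : [set e in _ | _] = [set box true i false j; box false (i + 1) true j;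
    box true i false (j + 1); box false i true j]).
  have -> : box true i false (j + 1) = [set (i + 1, j + 1); (i, j + 1)].
    by rewrite box_h setUC.
  have -> : box false i true j = [set (i, j + 1); (i, j)] by rewrite box_v setUC.
  rewrite box_hv box_h box_v; apply: is_cycle4.
  by rewrite /= !inE !xpair_eqE !succE // !andbF !andbT.
apply/setP => e; rewrite in_set !in_setU !in_set1;
apply/andP/idP => [[/edgeP[a [i' [j' ->]]]]|].
  rewrite box_sub !arc_sub //; case: a => /=; rewrite ?orbF ?andbT.
    by case/andP=> /eqP-> /orP[]/eqP->; rewrite eqxx ?orbT.
  by case/andP=> /orP[]/eqP-> /eqP->; rewrite eqxx ?orbT.
rewrite -!orbA; case/or4P=> /eqP->;
  by rewrite edge_box box_sub !arc_sub //= !eqxx ?orbT.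
Qed.

Lemma edges_atE i j : edges_at K (i, j) =
  [set box true i false j; box false i true j;
       box true (i - 1) false j; box false i true (j - 1)].
Proof.
apply/setP => e; rewrite in_set !in_setU !in_set1.
apply/andP/idP => [[/edgeP[a [i' [j' ->]]]]|].
  rewrite in_box !in_arc /=; case: a => /=; rewrite ?orbF.
    by case/andP=> /orP[] /eqP-> /eqP->; rewrite ?addrK eqxx ?orbT.
  by case/andP=> /eqP-> /orP[] /eqP->; rewrite ?addrK eqxx ?orbT.
rewrite -!orbA; case/or4P=> /eqP->;
  by rewrite edge_box in_box !in_arc /= ?subrK !eqxx ?orbT.
Qed.

Lemma face_atP i j F : reflect
  (exists c d : bool, F = box true (i - c%:R) true (j - d%:R))
  ((F \in faces K) && ((i, j) \in F)).
Proof.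
apply: (iffP andP) => [[/faceP[i' [j' ->]]]|[c [d ->]]].
  rewrite in_box !in_arc /= => /andP[] /orP[] /eqP-> /orP[] /eqP->.
  - by exists false, false; rewrite !subr0.
  - by exists false, true; rewrite subr0 addrK.
  - by exists true, false; rewrite subr0 addrK.
  - by exists true, true; rewrite !addrK.
rewrite face_box in_box !in_arc; split=> //=.
by case: c; case: d; rewrite ?subrK ?subr0 !eqxx ?orbT.
Qed.

(** The face in the quadrant selected by c and d joins, in the link of the
    vertex, the horizontal edge and the vertical edge of that quadrant. *)
Lemma edges_at_face i j (c d : bool) :
  [set e in edges_at K (i, j) | e \subset box true (i - c%:R) true (j - d%:R)] =
  [set box true (i - c%:R) false j; box false i true (j - d%:R)].
Proof.
apply/setP => e; rewrite edges_atE in_set !in_setU !in_set1.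
apply/andP/idP => [[]|].
  rewrite -!orbA => /or4P[] /eqP->; rewrite box_sub !arc_sub //=; case: c; case: d;
    rewrite /= ?subr0 ?subrK ?(eq_sym (_ - 1)) ?pred_eq ?succE //;
    by rewrite ?eqxx //= ?orbT.
case/orP=> /eqP->; rewrite box_sub !arc_sub //; case: c; case: d;
  by rewrite /= ?subr0 ?subrK ?eqxx ?orbT.
Qed.

Lemma link_cycle v : is_cycle (edges_at K v) (link_edges K v).
Proof.
case: v => i j.
have -> : link_edges K (i, j) =
    [set [set box true i false j; box false i true j];
         [set box false i true j; box true (i - 1) false j];
         [set box true (i - 1) false j; box false i true (j - 1)];
         [set box false i true (j - 1); box true i false j]].
  apply/setP => L; rewrite !in_setU !in_set1; apply/imsetP/idP => [[F]|].
    rewrite inE => /face_atP[c [d ->]] ->; rewrite edges_at_face.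
    case: c; case: d; rewrite /= ?subr0 ?eqxx ?orbT //.
      by rewrite (setUC [set box false i true j]) eqxx ?orbT.
    by rewrite (setUC [set box false i true (j - 1)]) eqxx ?orbT.
  (* The four joins of the cycle are those of the four quadrants at the vertex. *)
  have mem (c d : bool) : L = [set box true (i - c%:R) false j; box false i true (j - d%:R)] ->
      exists2 F : {set V}, F \in [set F in faces K | (i, j) \in F] &
        L = [set e in edges_at K (i, j) | e \subset F].
    move=> ->; exists (box true (i - c%:R) true (j - d%:R)); last by rewrite edges_at_face.
    by rewrite inE; apply/face_atP; exists c, d.
  rewrite -!orbA => /or4P[] /eqP EL.
  - by apply: (mem false false); rewrite !subr0.
  - by apply: (mem true false); rewrite subr0 EL setUC.
  - exact: (mem true true).
  - by apply: (mem false true); rewrite subr0 EL setUC.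
rewrite edges_atE; apply: is_cycle4.
rewrite /= !inE !negb_or -!andbA andbT.
by repeat (apply/andP; split); apply/eqP => /box_inj[] //;
  by [move=> _ /eqP; rewrite pred_eq| move=> _ _ _ /eqP; rewrite pred_eq].
Qed.

Lemma edge_degree e : e \in edges K -> #|[set F in faces K | e \subset F]| = 2.
Proof.
case/edgeP=> [] [] [i [j ->]].
  rewrite (_ : [set F in _ | _] = [set box true i true j; box true i true (j - 1)]).
    rewrite cards2; suff -> : box true i true j != box true i true (j - 1) by [].
    by apply/eqP => /box_inj[_ _ _ /eqP]; rewrite pred_eq.
  apply/setP => F; rewrite in_set in_set2; apply/andP/orP => [[/faceP[i' [j' ->]]]|].
    rewrite box_sub !arc_sub //= orbF !andbT => /andP[/eqP <-] /orP[] /eqP->.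
      by left.
    by right; rewrite addrK.
  by case=> /eqP->; rewrite face_box box_sub !arc_sub //= ?subrK !eqxx ?orbT.
rewrite (_ : [set F in _ | _] = [set box true i true j; box true (i - 1) true j]).
  rewrite cards2; suff -> : box true i true j != box true (i - 1) true j by [].
  by apply/eqP => /box_inj[_ /eqP]; rewrite pred_eq.
apply/setP => F; rewrite in_set in_set2; apply/andP/orP => [[/faceP[i' [j' ->]]]|].
  rewrite box_sub !arc_sub //= orbF !andbT => /andP[] /[swap] /eqP <- /orP[] /eqP->.
    by left.
  by right; rewrite addrK.
by case=> /eqP->; rewrite face_box box_sub !arc_sub //= ?subrK !eqxx ?orbT.
Qed.

Lemma connect_torus u v :
  connect (fun x y : V => [set x; y] \in edges K) u v.
Proof.
have sym : connect_sym (fun x y : V => [set x; y] \in edges K).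
  by apply: sym_connect_sym => x y; rewrite setUC.
suff H w : connect (fun x y : V => [set x; y] \in edges K) 0 w.
  by rewrite (connect_trans _ (H v)) // sym H.
have W (i j : nat) : connect (fun x y : V => [set x; y] \in edges K) 0 (i%:R, j%:R).
  elim: j => [|j IH].
    elim: i => [|i IH]; first exact: connect0.
    apply: connect_trans IH (connect1 _).
    by rewrite edge_step -natr1 !inE !xpair_eqE /= subrr addrC addKr !eqxx.
  apply: connect_trans IH (connect1 _).
  by rewrite edge_step -[j.+1%:R]natr1 !inE !xpair_eqE /= subrr addrC addKr !eqxx !orbT.
by case: w => i j; have := W i j; rewrite !natr_Zp.
Qed.

Lemma torus_surface : polygonized_closed_surface K.
Proof.
split; [exact: polygonal_torus|exact: edge_degree|exact: link_cycle|].
exact: connect_torus.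
Qed.

(** * Automorphisms are affine *)

Lemma aut_cell s c : s \in complex_aut K -> c \in cells K -> s @: c \in cells K.
Proof. by rewrite inE => /forall_inP; apply. Qed.

Lemma edge_cell e : e \in edges K -> e \in cells K.
Proof. by move=> eK; rewrite !in_setU eK orbT. Qed.

Lemma face_cell F : F \in faces K -> F \in cells K.
Proof. by move=> eK; rewrite in_setU eK orbT. Qed.

Lemma aut_face s F : s \in complex_aut K -> F \in faces K -> s @: F \in faces K.
Proof.
move=> sK FK; apply: cell_face; first by rewrite aut_cell ?face_cell.
rewrite card_imset; last exact: perm_inj.
by case/faceP: FK => i [j ->]; rewrite card_box.
Qed.

Lemma aut_edge s e : s \in complex_aut K -> e \in edges K -> s @: e \in edges K.
Proof.
move=> sK eK; apply: cell_edge; first by rewrite aut_cell ?edge_cell.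
rewrite card_imset; last exact: perm_inj.
by case/edgeP: eK => -[] [i [j ->]]; rewrite card_box.
Qed.

Lemma aut_step s u v : s \in complex_aut K ->
  (s v - s u \in steps) = (v - u \in steps).
Proof.
move=> sK; rewrite -!edge_step.
have E : [set s u; s v] = s @: [set u; v] by rewrite imsetU1 imset_set1.
rewrite E; apply/idP/idP => [|/(aut_edge sK) //].
move/(aut_edge (groupVr sK)); rewrite -imset_comp (eq_imset (g := id)) ?imset_id //.
by move=> x /=; rewrite permK.
Qed.

(** Both diagonals of a square have the same sum of end points. *)
Lemma face_diagonal i j u v : u \in box true i true j -> v \in box true i true j ->
  u != v -> v - u \notin steps -> u + v = (i + i + 1, j + j + 1).
Proof.
rewrite !in_box !in_arc -adj_step /cartesian_adj /cycle_adj.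
case: u v => [u u'] [v v'] /=.
case/andP=> /orP[] /eqP-> /orP[] /eqP-> /andP[] /orP[] /eqP-> /orP[] /eqP->;
  rewrite ?eqxx ?orbT //= => _ _; rewrite addVE /= ?[_ + 1 + _]addrAC ?addrA //.
Qed.

(** The opposite corners u and u + (d, d') of a face are distinct and not
    adjacent.  This is preserved by s, so both diagonals of the face are sent to
    diagonals of the image face, which have the same sum by [face_diagonal]. *)
Lemma aut_parallelogram s u (d : 'Z_n) (d' : 'Z_k) : s \in complex_aut K ->
  d \in [:: 1; -1] -> d' \in [:: 1; -1] ->
  s u + s (u + (d, d')) = s (u + (d, 0)) + s (u + (0, d')).
Proof.
move=> sK dE dE'.
have side m (x e : 'Z_m) : e \in [:: 1; -1] ->
    exists z, (x \in arc true z) && (x + e \in arc true z).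
  rewrite !inE => /orP[] /eqP->; [exists x | exists (x - 1)];
  by rewrite !in_arc ?subrK !eqxx ?orbT.
have [i /andP[ui ud]] := side _ u.1 _ dE; have [j /andP[uj ud']] := side _ u.2 _ dE'.
have n0 m (e : 'Z_m) : e \in [:: 1; -1] -> e != 0.
  by rewrite !inE => /orP[] /eqP->; rewrite ?oppr_eq0 oner_eq0.
have /faceP[i' [j' E]] : s @: box true i true j \in faces K.
  by rewrite aut_face // face_box.
have mem x : x \in box true i true j -> s x \in box true i' true j'.
  by rewrite -E => xF; rewrite imset_f.
have diag x y : x \in box true i true j -> y \in box true i true j ->
    x.1 != y.1 -> x.2 != y.2 -> s x + s y = (i' + i' + 1, j' + j' + 1).
  move=> xF yF n1 n2; apply: face_diagonal; rewrite ?mem ?aut_step //.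
    by rewrite (inj_eq perm_inj); apply: contra n1 => /eqP->.
  rewrite -adj_step /cartesian_adj.
  by rewrite (negPf n1) (negPf n2).
have neq m (x e : 'Z_m) : e \in [:: 1; -1] -> (x == x + e) = false.
  by move=> /n0 e0; rewrite -subr_eq0 opprD addNKr oppr_eq0 (negPf e0).
rewrite !diag ?in_box ?addVE /= ?addr0 ?ui ?ud ?uj ?ud' ?neq //.
by rewrite eq_sym neq.
Qed.

(** The four steps from s u to the images of the neighbours of u are distinct,
    and two of them that come from perpendicular steps at u cannot be opposite,
    as then s would identify opposite corners of a face.  So opposite steps stay
    opposite: s maps straight lines to straight lines. *)
Lemma aut_straight s u : s \in complex_aut K ->
  s (u + (1, 0)) - s u = s u - s (u - (1, 0)) /\
  s (u + (0, 1)) - s u = s u - s (u - (0, 1)).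
Proof.
move=> sK.
pose D d := s (u + d) - s u.
have Dinj : injective D by move=> d d' /addIr/perm_inj/addrI.
have Dstep d : d \in steps -> D d \in steps.
  by rewrite aut_step // addrC addKr.
have ND d d' : d \in [:: 1; -1] -> d' \in [:: 1; -1] ->
    D (d, 0) != - D (0, d').
  move=> dE dE'; rewrite -addr_eq0 /D addrACA -(aut_parallelogram u sK dE dE').
  rewrite addrACA subrr add0r subr_eq0 (inj_eq perm_inj).
  rewrite -subr_eq0 addrC addKr xpair_eqE negb_and.
  by move: dE; rewrite !inE => /orP[] /eqP->; rewrite ?oppr_eq0 oner_eq0.
(* There are only four steps, so the four images exhaust them. *)
have opp d : d \in steps -> - D d \in map D steps.
  have uD : uniq (map D steps) by rewrite map_inj_uniq ?uniq_steps.
  have sD : {subset map D steps <= steps}.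
    by move=> _ /mapP[e eS ->]; exact: Dstep.
  have [_ ->] := uniq_min_size uD sD (leqnn _).
  by move=> dS; rewrite stepN Dstep.
have nN d : d \in steps -> - D d != D d by move=> dS; rewrite step_neqN ?Dstep.
have i1 m : (1 : 'Z_m) \in [:: 1; -1] by rewrite mem_head.
have iN m : (-1 : 'Z_m) \in [:: 1; -1] by rewrite !inE eqxx orbT.
have E1 : - D (1, 0) = D (-1, 0).
  have := opp (1, 0) isT; rewrite !inE (negPf (nN _ _)) //= => /or3P[] /eqP // E.
    by have := ND _ _ (i1 _) (i1 _); rewrite -E opprK eqxx.
  by have := ND _ _ (i1 _) (iN _); rewrite -E opprK eqxx.
have E2 : - D (0, 1) = D (0, -1).
  have e2 : (0, 1) \in steps by rewrite !inE eqxx !orbT.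
  have := opp _ e2; rewrite !inE (negPf (nN _ e2)) /= => /or3P[] /eqP // E.
    by have := ND _ _ (i1 _) (i1 _); rewrite E eqxx.
  by have := ND _ _ (iN _) (i1 _); rewrite E eqxx.
have N1 : - (1, 0) = (-1, 0) :> V by apply/eqP; rewrite xpair_eqE oppr0 !eqxx.
have N2 : - (0, 1) = (0, -1) :> V by apply/eqP; rewrite xpair_eqE oppr0 !eqxx.
by split; apply: oppr_inj; rewrite [in RHS]opprB ?N1 ?N2; [exact: E1|exact: E2].
Qed.

Lemma torus_constant (T : Type) (g : V -> T) :
  (forall u, g (u + (1, 0)) = g u) -> (forall u, g (u + (0, 1)) = g u) ->
  forall u, g u = g 0.
Proof.
move=> g1 g2 [i j]; rewrite -[i]natr_Zp -[j]natr_Zp.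
elim: (val j) => [|j' IH].
  elim: (val i) => [|i' IH] //=.
  by rewrite -IH -(g1 (i'%:R, _)) addVE /= addr0 natr1.
by rewrite -IH -(g2 (_, j'%:R)) addVE /= addr0 natr1.
Qed.

(** The step s (u + e) - s u along a coordinate direction e does not depend on
    u: it is constant in the direction of e by [aut_straight] and in the other
    direction by [aut_parallelogram]. *)
Lemma aut_affine s (i j : nat) : s \in complex_aut K ->
  s (i%:R, j%:R) = s 0 + (s (1, 0) - s 0) *+ i + (s (0, 1) - s 0) *+ j.
Proof.
move=> sK.
have i1 m : (1 : 'Z_m) \in [:: 1; -1] by rewrite mem_head.
have par u : s (u + (1, 1)) = s (u + (1, 0)) + s (u + (0, 1)) - s u.
  by rewrite -aut_parallelogram ?i1 // [s u + _]addrC addrK.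
have D1 u : s (u + (1, 0)) - s u = s (0 + (1, 0)) - s 0.
  apply: (torus_constant (g := fun u => s (u + (1, 0)) - s u)) => {}u.
    by have [-> _] := aut_straight (u + (1, 0)) sK; rewrite addrK.
  have -> : u + (0, 1) + (1, 0) = u + (1, 1).
    by rewrite -addrA; congr (_ + _); rewrite addVE /= addr0 add0r.
  by rewrite par addrAC addrK.
have D2 u : s (u + (0, 1)) - s u = s (0 + (0, 1)) - s 0.
  apply: (torus_constant (g := fun u => s (u + (0, 1)) - s u)) => {}u.
    have -> : u + (1, 0) + (0, 1) = u + (1, 1).
      by rewrite -addrA; congr (_ + _); rewrite addVE /= addr0 add0r.
    by rewrite par addrAC [s (u + (1, 0)) + _]addrC addrK.
  by have [_ ->] := aut_straight (u + (0, 1)) sK; rewrite addrK.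
move: D1 D2; rewrite !add0r; set d1 := s (1, 0) - _; set d2 := s (0, 1) - _ => D1 D2.
elim: j => [|j IH]; first elim: i => [|i IH].
- by rewrite !mulr0n !addr0.
- have -> : (i.+1%:R, 0%:R) = (i%:R, 0%:R) + (1, 0) :> V by rewrite addVE /= addr0 natr1.
  by rewrite -[LHS](subrK (s (i%:R, 0%:R))) D1 IH !mulr0n !addr0 mulrS addrCA.
have -> : (i%:R, j.+1%:R) = (i%:R, j%:R) + (0, 1) :> V by rewrite addVE /= addr0 natr1.
by rewrite -[LHS](subrK (s (i%:R, j%:R))) D2 IH [d2 *+ _.+1]mulrS addrCA.
Qed.

Lemma mulVn u (m : nat) : u *+ m = (u.1 *+ m, u.2 *+ m).
Proof. by elim: m => [|m IH]; rewrite ?mulr0n // !mulrS IH. Qed.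

Lemma stepP (d : V) : reflect
  (exists a : bool, d = ((-1) ^+ a, 0) \/ d = (0, (-1) ^+ a)) (d \in steps).
Proof.
apply: (iffP idP) => [|[a [] ->]]; rewrite !inE.
  case/or4P=> /eqP->; [exists false|exists true|exists false|exists true];
  by rewrite ?expr0 ?expr1; (left; reflexivity) || (right; reflexivity).
all: by case: a; rewrite ?expr0 ?expr1 eqxx ?orbT.
Qed.

(** The two steps of [aut_affine] are neither equal nor opposite, so one is
    horizontal and the other is vertical.  In the swapping case the coordinates
    are written as multiples, since 'Z_n and 'Z_k are different types until
    [swapping_aut_eq] identifies n and k. *)
Lemma aut_classification s : s \in complex_aut K ->
  (exists t t' (a b : bool), forall i j,
     s (i, j) = (t + (-1) ^+ a * i, t' + (-1) ^+ b * j)) \/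
  (exists t t' (a b : bool), forall i j : nat,
     s (i%:R, j%:R) = (t + (-1) ^+ a *+ j, t' + (-1) ^+ b *+ i)).
Proof.
move=> sK; pose d1 := s (1, 0) - s 0; pose d2 := s (0, 1) - s 0.
have A (i j : nat) := aut_affine i j sK; rewrite -/d1 -/d2 in A.
have d1S : d1 \in steps by rewrite aut_step // subr0 !inE eqxx.
have d2S : d2 \in steps by rewrite aut_step // subr0 !inE eqxx !orbT.
have d12 : d1 != d2.
  by rewrite (inj_eq (addIr _)) (inj_eq perm_inj) xpair_eqE oner_eq0.
have dN : d1 + d2 != 0.
  apply/eqP => d0; have := A 1 1; rewrite !mulr1n -addrA d0 addr0 => /perm_inj/eqP.
  by rewrite xpair_eqE oner_eq0.
have signs m (a b : bool) :
    ((-1) ^+ a == (-1) ^+ b :> 'Z_m) || ((-1) ^+ a + (-1) ^+ b == 0 :> 'Z_m).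
  by case: a; case: b; rewrite ?expr0 ?expr1 ?addNr ?subrr eqxx ?orbT.
case: (s 0) A => t t' A.
case/stepP: d1S => a [] E1; case/stepP: d2S => b [] E2.
- by have := signs n a b; move: d12 dN; rewrite E1 E2 addVE !xpair_eqE /= addr0 eqxx !andbT;
    do 2 case: (_ == _).
- left; exists t, t', a, b => i j; rewrite -{1}[i]natr_Zp -{1}[j]natr_Zp A E1 E2.
  rewrite !mulVn !addVE /= !mul0rn !addr0.
  by rewrite -[_ *+ i]mulr_natr -[_ *+ j]mulr_natr !natr_Zp.
- right; exists t, t', b, a => i j; rewrite A.
  rewrite E1 E2.
  by rewrite !mulVn !addVE /= !mul0rn !addr0.
- by have := signs k a b; move: d12 dN; rewrite E1 E2 addVE !xpair_eqE /= ?addr0 ?eqxx /=;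
    do 2 case: (_ == _).
Qed.

(** n steps along the first cycle lead back to the start; their images are n
    steps along the second cycle, so k divides n, and conversely. *)
Lemma swapping_aut_eq (s : {perm V}) t t' (a b : bool) :
  (forall i j : nat, s (i%:R, j%:R) = (t + (-1) ^+ a *+ j, t' + (-1) ^+ b *+ i)) ->
  n = k.
Proof.
move=> sE; have s0 := sE 0 0.
have dvd m (h : (1 < m)%N) (c : bool) l (x : 'Z_m) : x + (-1) ^+ c *+ l = x -> (m %| l)%N.
  rewrite -[RHS]addr0 => /addrI E.
  have {E} : l%:R = 0 :> 'Z_m by rewrite -(signrMK c l%:R) mulr_natr E mulr0.
  by move/(congr1 (@nat_of_ord _)); rewrite val_Zp_nat // => E; apply/eqP.
apply/eqP; rewrite eqn_dvd; apply/andP; split.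
  have := sE 0 k; rewrite (pchar_Zp (ltnW k_gt2)) s0 !mulr0n !addr0 => -[E].
  by apply: dvd (ltnW n_gt2) _ _ _ (esym E).
have := sE n 0; rewrite (pchar_Zp (ltnW n_gt2)) s0 !mulr0n !addr0 => -[E].
by apply: dvd (ltnW k_gt2) _ _ _ (esym E).
Qed.

End TorusComplex.

(** * Transitivity of the automorphism group *)

Section Transitivity.
Local Open Scope set_scope.

Definition dihedral n (t : 'Z_n) (a : bool) (i : 'Z_n) : 'Z_n := t + (-1) ^+ a * i.

Lemma dihedral_inj n t a : injective (@dihedral n t a).
Proof. by move=> i j /addrI; apply: can_inj (signrMK a) i j. Qed.

(** The edge with ends i and i + 1 is indexed by i; a reflection reverses the
    order of the ends, whence the correction by 1. *)
Lemma dihedral_arc n t a b i :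
  @dihedral n t a @: arc b i = arc b (dihedral t a i - (a && b)%:R).
Proof.
rewrite /dihedral; case: b; rewrite /arc ?imsetU1 imset_set1; case: a => /=.
all: rewrite ?expr0 ?expr1 ?mul1r ?subr0 ?mulN1r ?opprD ?addrA ?subrK //.
by rewrite setUC.
Qed.

Section Rectangular.
Variables n k : nat.
Hypotheses (n_gt2 : (2 < n)%N) (k_gt2 : (2 < k)%N).
Local Notation V := ('Z_n * 'Z_k)%type.
Local Notation K := (torus_quad n k).

Definition dihedral2 (v : V) (a b : bool) (x : V) : V :=
  (dihedral v.1 a x.1, dihedral v.2 b x.2).

Lemma dihedral2_inj v a b : injective (dihedral2 v a b).
Proof.
move=> [x y] [x' y'] E; congr pair.
  exact: dihedral_inj (congr1 fst E).
exact: dihedral_inj (congr1 snd E).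
Qed.

Definition dihedral2_perm v a b : {perm V} := perm (@dihedral2_inj v a b).

Lemma dihedral2_box v a b c i d j : dihedral2_perm v a b @: box c i d j =
  box c (dihedral v.1 a i - (a && c)%:R) d (dihedral v.2 b j - (b && d)%:R).
Proof.
rewrite /box -!dihedral_arc -imset_setX.
by apply: eq_imset => x; rewrite permE.
Qed.

Lemma dihedral2_aut v a b : dihedral2_perm v a b \in complex_aut K.
Proof.
rewrite inE; apply/forall_inP => _ /cellP[c [i [d [j ->]]]].
by apply/cellP; rewrite dihedral2_box; do 4 eexists.
Qed.

Lemma torus_vertex_transitive : vertex_transitive K.
Proof.
apply/imsetP; exists 0; rewrite ?inE //; apply/setP => v; rewrite in_setT.
apply/esym/imsetP; exists (dihedral2_perm v false false); first exact: dihedral2_aut.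
by rewrite /= apermE permE /dihedral2 /dihedral !mulr0 !addr0 -surjective_pairing.
Qed.

Lemma torus_face_transitive : face_transitive K.
Proof.
have act (s : {perm V}) A : setact 'P A s = s @: A.
  by apply: eq_imset => x; rewrite /= apermE.
apply/imsetP; exists (box true 0 true 0); first by rewrite face_box.
apply/setP => F; apply/faceP/imsetP => [[i [j ->]]|[s sK ->]].
  exists (dihedral2_perm (i, j) false false); first exact: dihedral2_aut.
  by rewrite /= act dihedral2_box /dihedral /= !mulr0 !addr0 !subr0.
by apply/faceP; rewrite /= act (aut_face sK) ?face_box.
Qed.

End Rectangular.

Section Square.
Variable n : nat.
Hypothesis n_gt2 : (2 < n)%N.
Local Notation V := ('Z_n * 'Z_n)%type.
Local Notation K := (torus_quad n n).

Definition swap (x : V) : V := (x.2, x.1).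

Lemma swap_inj : injective swap.
Proof.
by move=> [x y] [x' y'] E; congr pair; [have := congr1 snd E|have := congr1 fst E].
Qed.

Definition swap_perm : {perm V} := perm swap_inj.

Lemma swap_box c i d j : swap_perm @: box c i d j = box d j c i.
Proof.
apply/setP => -[x y]; apply/imsetP/idP => [[[x' y'] + ->]|].
  by rewrite permE !in_box /= andbC.
by rewrite in_box => xy; exists (y, x); rewrite ?permE // in_box andbC.
Qed.

Lemma swap_aut : swap_perm \in complex_aut K.
Proof.
rewrite inE; apply/forall_inP => _ /cellP[c [i [d [j ->]]]].
by apply/cellP; rewrite swap_box; do 4 eexists.
Qed.

(** Any flag can be moved to the standard flag at the origin: a translation and
    reflections bring its face to the standard one with its vertex at 0, and
    then the edge is one of the two edges at 0, which the swap exchanges. *)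
Lemma flag_standard v e F : flag K v e F ->
  exists2 s : {perm V}, s \in complex_aut K &
    [/\ s v = 0, s @: e = box true 0 false 0 & s @: F = box true 0 true 0].
Proof.
case/and5P=> ve vF eF eK /faceP[i [j EF]].
(* A coordinate i of F is reflected exactly if v has the coordinate i + 1. *)
pose a := v.1 != i; pose b := v.2 != j.
pose s := dihedral2_perm (- dihedral 0 a v.1, - dihedral 0 b v.2) a b.
have sK : s \in complex_aut K by apply: dihedral2_aut.
have sv : s v = 0.
  by rewrite permE /dihedral2 /dihedral /= !add0r !addNr.
have sF : s @: F = box true 0 true 0.
  have corner (x y : 'Z_n) : x \in arc true y ->
      dihedral (- dihedral 0 (x != y) x) (x != y) y - ((x != y) && true)%:R = 0.
    rewrite in_arc /= /dihedral add0r; case: eqVneq => [->|_ /eqP->] /=.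
      by rewrite addNr subrr.
    by rewrite expr1 !mulN1r opprK addrAC addrK addrN.
  move: vF; rewrite EF in_box => /andP[v1 v2]; rewrite dihedral2_box.
  by congr box; exact: corner.
have := aut_edge sK eK; have := imset_f s ve; have := imsetS s eF.
rewrite sF sv => + + /edgeP[c [x [y se]]]; rewrite se.
have z1 : (0 == 0 + 1 :> 'Z_n) = false by rewrite succE.
rewrite box_sub in_box !arc_sub // !in_arc; case: c se => /= se.
  rewrite !orbF !andbT => /andP[/eqP E1 _] /andP[_ /eqP E2]; exists s => //.
  by rewrite se E1 -E2.
rewrite !orbF !andbT => /andP[_ /eqP E1] /andP[/eqP E2 _].
exists (s * swap_perm)%g; first by rewrite groupM ?swap_aut.
have sw (A : {set V}) : (s * swap_perm)%g @: A = swap_perm @: (s @: A).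
  by rewrite -imset_comp; apply: eq_imset => w; rewrite /= permM.
by rewrite !sw se sF !swap_box permM sv permE E1 -E2; split.
Qed.

Lemma torus_flag_transitive : flag_transitive K.
Proof.
move=> v e F v' e' F' /flag_standard[s sK [sv se sF]] /flag_standard[s' sK' [sv' se' sF']].
have back (A B : {set V}) : s @: A = s' @: B -> (s * s'^-1)%g @: A = B.
  move=> AB; transitivity ((s' * s'^-1)%g @: B); last first.
    by rewrite mulgV (eq_imset B (@perm1 V)) imset_id.
  have M (f g : {perm V}) (C : {set V}) : (f * g)%g @: C = g @: (f @: C).
    by rewrite -imset_comp; apply: eq_imset => w; rewrite /= permM.
  by rewrite !M AB.
exists (s * s'^-1)%g; first by rewrite groupM ?groupV.
by split; [rewrite permM sv -sv' permK|apply: back; rewrite se|apply: back; rewrite sF].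
Qed.

End Square.
End Transitivity.

From mathcomp Require Import all_classical all_reals all_analysis.
From mathcomp Require Import ring lra.

Import Order.TTheory Num.Theory numFieldNormedType.Exports.

Local Open Scope classical_set_scope.

(** * Convex hulls and exposed cells *)

Section Hulls.
Variables (R : realType) (V : finType) (d : nat) (f : V -> 'rV[R]_d).
Implicit Types c e F : {set V}.

Lemma sum_supported (M : nmodType) (g : V -> M) (A B : {set V}) :
  B \subset A -> (forall v, v \in A -> v \notin B -> g v = 0) ->
  \sum_(v in A) g v = \sum_(v in B) g v.
Proof.
move=> BA g0; rewrite (big_setID B) /= (finset.setIidPr BA) [X in _ + X]big1 ?addr0 //.
by move=> v /setDP[]; exact: g0.
Qed.

Lemma hull_subset c c' : c \subset c' -> hull f c `<=` hull f c'.
Proof.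
move=> cc' x [w [w0 w1 ->]]; exists (fun v => if v \in c then w v else 0).
split=> [v _||]; first by case: ifP => [/w0|].
  rewrite (sum_supported cc') => [|v _ /negPf->//]; rewrite -w1.
  by apply: eq_bigr => v ->.
rewrite (sum_supported cc') => [|v _ /negPf->]; last by rewrite scale0r.
by apply: eq_bigr => v ->.
Qed.

Definition exposed c := exists (a : 'cV[R]_d) b, forall v,
  (v \in c -> (f v *m a) 0 0 = b) /\ (v \notin c -> (f v *m a) 0 0 < b).

Lemma exposed_side e F : exposed e -> side_of f e F.
Proof.
case=> a [b ab]; exists a, b; split=> [v ve|v _ ve].
  exact: (ab v).1.
exact: (ab v).2.
Qed.

Lemma hull_neq0 c x : hull f c x -> exists v, v \in c.
Proof.
case=> w [_ w1 _]; have [E|[v vc]] := set_0Vmem c; last by exists v.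
by move: w1; rewrite E big_set0 => /eqP; rewrite eq_sym oner_eq0.
Qed.

(** The linear form that exposes c2 takes its maximum b at x, which is also an
    average over c1 of values at most b; so only the vertices of c1 where the
    value is b, those in c2, can have positive weight. *)
Lemma exposed_hullI c1 c2 x : exposed c2 -> hull f c1 x -> hull f c2 x ->
  hull f (c1 :&: c2)%SET x.
Proof.
case=> a [b ab] [w [w0 w1 xE]] [w' [_ w'1 xE']].
have val c (u : V -> R) : ((\sum_(v in c) u v *: f v) *m a) 0 0 =
    \sum_(v in c) u v * (f v *m a) 0 0.
  rewrite mulmx_suml summxE; apply: eq_bigr => v _.
  by rewrite -scalemxAl mxE.
have xb : (x *m a) 0 0 = b.
  rewrite xE' val -[RHS]mul1r -w'1 mulr_suml; apply: eq_bigr => v vc.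
  by rewrite (ab v).1.
have slack : \sum_(v in c1) w v * (b - (f v *m a) 0 0) = 0.
  under eq_bigr do rewrite mulrBr.
  by rewrite sumrB -mulr_suml w1 mul1r -val -xE xb subrr.
have supp v : v \in c1 -> v \notin c2 -> w v = 0.
  move=> v1 v2; have lt := (ab v).2 v2.
  have := slack => /eqP; rewrite psumr_eq0; last first.
    move=> u u1; rewrite mulr_ge0 ?w0 // subr_ge0.
    by have [u2|u2] := boolP (u \in c2); [rewrite (ab u).1|rewrite ltW // (ab u).2].
  move=> /allP/(_ v (mem_index_enum v)); rewrite v1 /= mulf_eq0 subr_eq0.
  by rewrite (gt_eqF lt) orbF => /eqP.
have sub := finset.subsetIl c1 c2.
exists w; split=> [v /setIP[/w0//]||].
  by rewrite -(sum_supported sub) // => v v1; rewrite inE v1; exact: supp.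
rewrite xE (sum_supported sub) // => v v1; rewrite inE v1 => v2.
by rewrite supp // scale0r.
Qed.

End Hulls.

(** * Regular polygons in the plane *)

Lemma continuous_row (R : realType) (T : topologicalType) m (f : T -> 'rV[R]_m) (z : T) :
  (forall j : 'I_m, {for z, continuous (fun u => f u 0 j)}) -> {for z, continuous f}.
Proof.
move=> cf A [B fB BA].
apply: (@filterS _ (nbhs z) _ [set u | forall j : 'I_m, B 0 j (f u 0 j)]).
  by move=> u Bu; apply: BA => l j; rewrite (ord1 l).
by apply: filter_forall => j; exact: (cf j _ (fB 0 j)).
Qed.

Section Plane.
Variable R : realType.
Implicit Types (x y : 'rV[R]_2) (s t : R).

Definition dot d (x y : 'rV[R]_d) : R := (x *m y^T) 0 0.

Lemma dot2E x y : dot x y = x 0 0 * y 0 0 + x 0 1 * y 0 1.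
Proof.
rewrite /dot mxE !big_ord_recl big_ord0 addr0 !mxE.
by rewrite (_ : lift ord0 ord0 = 1) //; exact/val_inj.
Qed.

Lemma row2P x y : x 0 0 = y 0 0 -> x 0 1 = y 0 1 -> x = y.
Proof.
move=> E0 E1; apply/rowP => i; case: (unliftP 0 i) => [j|] -> //.
by rewrite (ord1 j) (_ : lift 0 0 = 1) //; exact/val_inj.
Qed.

Definition vec2 (p : R * R) : 'rV[R]_2 := \row_j (if j == 0 then p.1 else p.2).

Lemma vec2E p : (vec2 p 0 0 = p.1) * (vec2 p 0 1 = p.2).
Proof. by rewrite !mxE. Qed.

Definition cis t : 'rV[R]_2 := vec2 (cos t, sin t).

Lemma dot_cis s t : dot (cis s) (cis t) = cos (s - t).
Proof. by rewrite dot2E !vec2E cosB. Qed.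

(** The rotation by t, preceded by the reflection in the first axis if b holds,
    acting on row vectors from the right. *)
Definition plane_isometry (t : R) (b : bool) : 'M[R]_2 :=
  \matrix_(i, j) if i == 0 then cis t 0 j else
    (-1) ^+ b * cis (t + pi / 2) 0 j.

Lemma cis_plane_isometry t b s : cis s *m plane_isometry t b = cis (t + (-1) ^+ b * s).
Proof.
have E j : (cis s *m plane_isometry t b) 0 j =
    cos s * cis t 0 j + sin s * ((-1) ^+ b * cis (t + pi / 2) 0 j).
  rewrite mxE !big_ord_recl big_ord0 addr0 !mxE /=; congr (_ + _).
apply: row2P; rewrite E !vec2E /= ?cosDpihalf ?sinDpihalf; case: b {E};
  by rewrite /= ?expr0 ?expr1 ?mulN1r ?mul1r ?cosB ?sinB ?cosD ?sinD; ring.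
Qed.

Lemma plane_isometry_orthogonal t b : plane_isometry t b *m (plane_isometry t b)^T = 1%:M.
Proof.
have b2 : (-1) ^+ b * (-1) ^+ b = 1 :> R by rewrite -expr2 sqrr_sign.
have cs := cos2Dsin2 t.
apply/matrixP => i j; rewrite mxE !big_ord_recl big_ord0 addr0 !mxE /=.
rewrite cosDpihalf sinDpihalf.
case: (unliftP 0 i) => [i'|] ->; case: (unliftP 0 j) => [j'|] ->;
  rewrite ?(ord1 i') ?(ord1 j') /= ?mulr1n ?mulr0n; rewrite -?cs -?b2; try ring.
by rewrite -[RHS]mul1r -b2 -cs; ring.
Qed.

(** The cosine is decreasing on [0, pi] and symmetric about pi. *)
Lemma cos_lt_cos s t : 0 <= s -> s < t -> t < pi *+ 2 - s -> cos t < cos s.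
Proof.
move=> s0 st tp; have p0 := pi_gt0 R.
have [tpi|tpi] := leP t pi.
  rewrite ltr_cos // in_itv /=; apply/andP; split; lra.
rewrite -(cosN t) -(cosD2pi (- t)) ltr_cos ?in_itv /=; lra.
Qed.

End Plane.

Section Polygon.
Variables (R : realType) (n : nat).
Hypothesis n_gt2 : (2 < n)%N.
Implicit Types (i j : 'Z_n) (x y : 'rV[R]_2).

Definition half_angle : R := pi / n%:R.
Local Notation h := half_angle.
Definition angle i : R := (val i)%:R * (h *+ 2).
Definition corner i : 'rV[R]_2 := cis (angle i).

Lemma half_angle_gt0 : 0 < h.
Proof. by rewrite divr_gt0 ?pi_gt0 // ltr0n (ltn_trans _ n_gt2). Qed.

Lemma half_angleE : n%:R * h = pi.
Proof. by rewrite mulrC divfK // pnatr_eq0; case: n n_gt2. Qed.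

Lemma cos_half_angle : 0 < cos h.
Proof.
have h0 := half_angle_gt0; have n3 : 3 <= n%:R :> R by rewrite (ler_nat R 3).
have := half_angleE => hE; apply: cos_gt0_pihalf; nra.
Qed.

Lemma sin_half_angle : 0 < sin h.
Proof.
have h0 := half_angle_gt0; have n3 : 3 <= n%:R :> R by rewrite (ler_nat R 3).
have := half_angleE => hE; apply: sin_gt0_pi; nra.
Qed.

(** The angle is 2 pi / n times a representative of the residue, so all that
    depends on it is well defined modulo n.  The offset t makes the lemma apply
    to the normals of the sides, at half-integral multiples, as well. *)
Lemma cis_modn (m : nat) (t : R) :
  cis ((m %% n)%:R * (h *+ 2) + t) = cis (m%:R * (h *+ 2) + t).
Proof.
have -> : m%:R * (h *+ 2) + t = (m %% n)%:R * (h *+ 2) + t + pi *+ 2 *+ (m %/ n) :> R.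
  rewrite {1}(divn_eq m n) natrD natrM -half_angleE -[_ *+ (m %/ n)]mulr_natr; ring.
by apply: row2P; rewrite !vec2E /= periodicn //; [exact: cosD2pi|exact: sinD2pi].
Qed.

Lemma cis_angleD i j (t : R) : cis (angle (i + j) + t) = cis (angle i + angle j + t).
Proof.
rewrite -mulrDl -natrD -(cis_modn (_ + _)) /angle.
by congr (cis (_%:R * _ + _)); apply: (congr1 (modn _)); rewrite Zp_cast 1?ltnW.
Qed.

Lemma cis_angleB i j (t : R) : cis (angle (i - j) + t) = cis (angle i - angle j + t).
Proof.
have E := cis_angleD (i - j) j (t - angle j); rewrite subrK in E.
have -> : angle (i - j) + t = angle (i - j) + angle j + (t - angle j) by ring.
by rewrite -E; congr cis; ring.
Qed.

Lemma corner_plane_isometry t a i :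
  corner i *m plane_isometry (angle t) a = corner (dihedral t a i).
Proof.
rewrite /corner cis_plane_isometry -[angle (dihedral _ _ _)]addr0 /dihedral.
case: a => /=; rewrite ?expr0 ?expr1 ?mulN1r ?mul1r.
  by rewrite cis_angleB addr0.
by rewrite cis_angleD addr0.
Qed.

(** Among the odd multiples of pi / n, in one period, only those next to 0 reach
    the cosine of pi / n: the corners on the supporting line of a side are its
    ends. *)
Lemma cos_odd_angle i : i != 0 -> i != 1 -> cos (angle i - h) < cos h.
Proof.
move=> i0 i1; have h0 := half_angle_gt0; have hE := half_angleE.
have i2 : (2 <= val i)%N.
  have : val i != 0%N by apply: contra i0 => /eqP E; apply/eqP/val_inj.
  have : val i != 1%N.
    by apply: contra i1 => /eqP E; apply/eqP/val_inj; rewrite /= E.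
  by case: (val i) => [|[]].
have iR : 2 <= (val i)%:R :> R by rewrite (ler_nat R 2).
have iN : (val i)%:R + 1 <= n%:R :> R.
  by rewrite natr1 ler_nat; have := ltn_ord i; rewrite {2}Zp_cast // ltnW.
by rewrite /angle; apply: cos_lt_cos; nra.
Qed.

Lemma cos_angle_lt1 i : i != 0 -> cos (angle i) < 1.
Proof.
move=> i0; have h0 := half_angle_gt0; have hE := half_angleE.
have iR : 1 <= (val i)%:R :> R.
  by rewrite (ler_nat R 1) lt0n; apply: contra i0 => /eqP E; apply/eqP/val_inj.
have iN : (val i)%:R + 1 <= n%:R :> R.
  by rewrite natr1 ler_nat; have := ltn_ord i; rewrite {2}Zp_cast // ltnW.
by rewrite -cos0 /angle; apply: cos_lt_cos; nra.
Qed.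

Lemma angle0 : angle 0 = 0. Proof. by rewrite /angle mul0r. Qed.

Lemma angle1 : angle 1 = h *+ 2.
Proof. by rewrite /angle /= modn_small ?mul1r. Qed.

(** The linear form is the inner product with the direction of the centre of the
    arc: that of the corner itself, or that of the normal of the side. *)
Lemma arc_exposed a i : exists (m : 'rV[R]_2) c, forall j,
  (j \in arc a i -> dot (corner j) m = c) /\ (j \notin arc a i -> dot (corner j) m < c).
Proof.
pose d : R := if a then h else 0.
exists (cis (angle i + d)), (cos d) => j.
have -> : dot (corner j) (cis (angle i + d)) = cos (angle (j - i) - d).
  have := congr1 (fun x : 'rV_2 => x 0 0) (cis_angleB j i (- d)).
  rewrite !vec2E /= dot_cis => ->; congr cos; ring.
have E1 : (j == i) = (j - i == 0) by rewrite subr_eq0.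
have E2 : (j == i + 1) = (j - i == 1) by rewrite subr_eq addrC.
rewrite in_arc E1 E2; move: (j - i) => {E1 E2 j} j.
split; rewrite ?negb_or.
  case/orP=> [/eqP->|/andP[aT /eqP->]]; first by rewrite angle0 sub0r cosN.
  by rewrite angle1 /d aT mulr2n addrK.
rewrite /d; case: a {d} => /= /andP[j0 j1]; first exact: cos_odd_angle.
by rewrite subr0 cos0 cos_angle_lt1.
Qed.

Definition normal i : 'rV[R]_2 := cis (angle i + h).

(** Consecutive normals are symmetric about a corner, so their difference is
    perpendicular to that corner: comparing their support values at x tells on
    which side of the ray through the corner x lies. *)
Lemma dot_normal_succ x i : dot x (normal (i + 1)) - dot x (normal i) =
  (sin h *+ 2) * (corner (i + 1) 0 0 * x 0 1 - corner (i + 1) 0 1 * x 0 0).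
Proof.
rewrite /normal /corner -[angle (i + 1)]addr0 -!addrA !cis_angleD angle1 !dot2E !vec2E /=.
set t := angle i + h *+ 2 + 0.
have -> : angle i + h *+ 2 + (0 + h) = t + h by rewrite /t; ring.
have -> : angle i + h = t - h by rewrite /t; ring.
rewrite cosD sinD cosB sinB; ring.
Qed.

(** For a side whose normal has at least the same inner product with x as the
    normals of the two adjacent sides, [dot_normal_succ] says that x is on the inner side of both
    rays bounding the cone over that side; Cramer's rule gives the two
    coefficients. *)
Lemma cone_over_side x i :
  dot x (normal (i - 1)) <= dot x (normal i) ->
  dot x (normal (i + 1)) <= dot x (normal i) ->
  exists a b, [/\ 0 <= a, 0 <= b & x = a *: corner i + b *: corner (i + 1)].
Proof.
have s0 := sin_half_angle; have c0 := cos_half_angle.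
rewrite -subr_ge0 => L.
rewrite -subr_le0 dot_normal_succ pmulr_rle0 ?pmulrn_lgt0 // => A.
move: L; rewrite -{1}[i](subrK 1) dot_normal_succ subrK pmulr_rge0 ?pmulrn_lgt0 // => B.
pose D : R := cos h * sin h *+ 2.
have D0 : 0 < D by rewrite pmulrn_lgt0 // mulr_gt0.
have c1 : corner (i + 1) = cis (angle i + h *+ 2).
  by rewrite /corner -[angle _]addr0 cis_angleD angle1 addr0.
exists (- (corner (i + 1) 0 0 * x 0 1 - corner (i + 1) 0 1 * x 0 0) / D).
exists ((corner i 0 0 * x 0 1 - corner i 0 1 * x 0 0) / D).
split; [by apply: divr_ge0; [rewrite oppr_ge0|exact: ltW]|by apply: divr_ge0; [|exact: ltW]|].
have ndz : D != 0 by rewrite gt_eqF.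
have cs := cos2Dsin2 (angle i).
have DE : D = corner i 0 0 * corner (i + 1) 0 1 - corner i 0 1 * corner (i + 1) 0 0.
  rewrite c1 !vec2E /= cosD sinD -[RHS]mul1r.
  have -> : sin (h *+ 2) = D by rewrite sin_mulr2n.
  by rewrite mul1r -[LHS]mul1r -cs; ring.
clearbody D; apply: row2P; rewrite [RHS]mxE [X in _ = X + _]mxE [X in _ = _ + X]mxE;
  apply: (mulfI ndz); rewrite {1}DE; field; exact: ndz.
Qed.

Lemma corner_inj : injective corner.
Proof.
move=> i j ij; have [m [c mc]] := arc_exposed false i.
have [] := boolP (j \in arc false i); first by rewrite in_arc orbF => /eqP.
by move=> /(mc j).2; rewrite -ij (mc i).1 ?arc_id // ltxx.
Qed.

(** The Minkowski functional of the polygon; cos (pi / n) is the distance of the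
    sides from the centre. *)
Definition gauge x : R :=
  \big[Num.max/dot x (normal 0)]_i dot x (normal i) / cos h.

Lemma gauge_ge x i : dot x (normal i) <= gauge x * cos h.
Proof.
rewrite /gauge divfK ?gt_eqF ?cos_half_angle //.
exact: (le_bigmax _ (fun i => dot x (normal i))).
Qed.

Lemma gauge_attained x : exists2 i, dot x (normal i) = gauge x * cos h &
  forall j, dot x (normal j) <= dot x (normal i).
Proof.
suff [i E] : exists i, dot x (normal i) = gauge x * cos h.
  by exists i => // j; rewrite E gauge_ge.
rewrite /gauge divfK ?gt_eqF ?cos_half_angle //.
elim/big_ind: _ => [|a b [i <-] [j <-]|i _]; [by exists 0| |by exists i].
by case: leP => _; [exists j|exists i].
Qed.

Lemma gauge_unique x c : (forall i, dot x (normal i) <= c * cos h) ->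
  (exists i, dot x (normal i) = c * cos h) -> gauge x = c.
Proof.
move=> xc [j xj]; have [i xi _] := gauge_attained x.
apply: (mulIf (lt0r_neq0 cos_half_angle)); apply/eqP.
by rewrite eq_le -{1}xi xc -xj gauge_ge.
Qed.

Lemma dotZ x y (c : R) : dot (c *: x) y = c * dot x y.
Proof. by rewrite /dot -scalemxAl mxE. Qed.

Lemma dotD x y z : dot (x + y) z = dot x z + dot y z.
Proof. by rewrite /dot mulmxDl mxE. Qed.

Lemma gaugeZ x (c : R) : 0 <= c -> gauge (c *: x) = c * gauge x.
Proof.
move=> c0; apply: gauge_unique => [i|].
  by rewrite dotZ -mulrA ler_wpM2l // gauge_ge.
by have [i xi _] := gauge_attained x; exists i; rewrite dotZ xi mulrA.
Qed.

Lemma dot_corner_normal i : dot (corner i) (normal i) = cos h /\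
  dot (corner (i + 1)) (normal i) = cos h.
Proof.
split; first by rewrite dot_cis opprD addrA subrr sub0r cosN.
rewrite /corner -[angle (i + 1)]addr0 cis_angleD dot_cis angle1; congr cos; ring.
Qed.

(** On the cone over a side the maximum that defines the gauge is attained at the
    normal of that side, where both ends of the side have inner product
    cos (pi / n). *)
Lemma gauge_side i (a b : R) : 0 <= a -> 0 <= b ->
  gauge (a *: corner i + b *: corner (i + 1)) = a + b.
Proof.
move=> a0 b0; apply: gauge_unique => [j|]; last first.
  exists i; have [E1 E2] := dot_corner_normal i.
  by rewrite dotD !dotZ E1 E2 mulrDl.
have le l : dot (corner l) (normal j) <= cos h.
  have -> : dot (corner l) (normal j) = cos (angle (l - j) - h).
    have := congr1 (fun x : 'rV_2 => x 0 0) (cis_angleB l j (- h)).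
    rewrite !vec2E /= dot_cis => ->; congr cos; ring.
  have [->|l0] := eqVneq (l - j) 0; first by rewrite angle0 sub0r cosN.
  have [->|l1] := eqVneq (l - j) 1; first by rewrite angle1 mulr2n addrK.
  exact/ltW/cos_odd_angle.
by rewrite dotD !dotZ mulrDl lerD // ler_wpM2l.
Qed.

(** The normal at which the maximum is attained determines a cone containing x;
    hence the cones over the sides cover the plane. *)
Lemma gauge_cone x : exists i a b,
  [/\ 0 <= a, 0 <= b, x = a *: corner i + b *: corner (i + 1) & gauge x = a + b].
Proof.
have [i _ xi] := gauge_attained x.
have [a [b [a0 b0 E]]] := cone_over_side (xi _) (xi _).
by exists i, a, b; split=> //; rewrite {1}E gauge_side.
Qed.

Lemma gauge_gt0 x : x != 0 -> 0 < gauge x.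
Proof.
have [i [a [b [a0 b0 -> ->]]]] := gauge_cone x.
rewrite lt_def addr_ge0 // andbT; apply: contra.
by rewrite paddr_eq0 // => /andP[/eqP-> /eqP->]; rewrite !scale0r addr0.
Qed.

Lemma gauge0 : gauge 0 = 0.
Proof. by rewrite -(scale0r 0) gaugeZ // mul0r. Qed.

Lemma hull_sideP i x : hull corner (arc true i) x <->
  exists a b, [/\ 0 <= a, 0 <= b, a + b = 1 & x = a *: corner i + b *: corner (i + 1)].
Proof.
have neq : i != i + 1 by rewrite succE.
split=> [[w [w0 w1 ->]]|[a [b [a0 b0 ab ->]]]].
  exists (w i), (w (i + 1)); rewrite !w0 ?in_arc ?eqxx ?orbT //.
  by rewrite -w1 !big_setU1 ?inE //= !big_set1.
exists (fun j => if j == i then a else b); split=> [j _||]; first by case: ifP.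
all: by rewrite big_setU1 ?inE //= big_set1 eqxx eq_sym (negPf neq).
Qed.

(** In the coordinates of [gauge_cone], gauge 1 means that x is a convex
    combination of the two ends of a side. *)
Lemma gauge_boundary x : gauge x = 1 <-> exists a i, hull corner (arc a i) x.
Proof.
split=> [x1|[a [i xi]]].
  have [i [a [b [a0 b0 xE E]]]] := gauge_cone x.
  by exists true, i; apply/hull_sideP; exists a, b; split=> //; rewrite -E.
have /hull_sideP[b [c [b0 c0 bc ->]]] : hull corner (arc true i) x.
  by apply: hull_subset xi; rewrite arc_sub // eqxx; case: a.
by rewrite gauge_side.
Qed.

Lemma gauge_continuous : continuous gauge.
Proof.
have C i : continuous (fun x : 'rV[R]_2 => dot x (normal i)).
  rewrite (_ : (fun x => _) = (fun x => x 0 0 * normal i 0 0 + x 0 1 * normal i 0 1)).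
    move=> x; apply: (@continuousD _ R^o 'rV[R]_2 (fun x => x 0 0 * _) (fun x => x 0 1 * _)).
      apply: (@continuousM R 'rV[R]_2 (fun x => x 0 0) (fun=> _)); last exact: cst_continuous.
      exact: coord_continuous.
    apply: (@continuousM R 'rV[R]_2 (fun x => x 0 1) (fun=> _)); last exact: cst_continuous.
    exact: coord_continuous.
  by apply/funext => x; rewrite dot2E.
pose g r x := \big[Num.max/dot x (normal 0)]_(i <- r) dot x (normal i).
have G r : continuous (g r : 'rV[R]_2 -> R).
  elim: r => [|i r IH].
    by rewrite (_ : g _ = fun x => dot x (normal 0)) //; apply/funext => x; rewrite /g big_nil.
  rewrite (_ : g _ = (fun x => dot x (normal i)) \max g r); last first.
    by apply/funext => x; rewrite /g big_cons.
  by move=> x; exact: (continuous_max (C i x) (IH x)).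
move=> x; apply: (@continuousM R 'rV[R]_2 (g _) (fun=> _)); last exact: cst_continuous.
exact: G.
Qed.

(** * Radial projections between polygon and circle *)

Definition to_polygon (p : R * R) : 'rV[R]_2 := (gauge (vec2 p))^-1 *: vec2 p.

Definition enorm x : R := Num.sqrt (x 0 0 ^+ 2 + x 0 1 ^+ 2).

Definition to_circle x : R * R := (x 0 0 / enorm x, x 0 1 / enorm x).

Lemma enorm_gt0 x : x != 0 -> 0 < enorm x.
Proof.
move=> x0; rewrite sqrtr_gt0 lt_def addr_ge0 ?sqr_ge0 // andbT.
apply: contra x0; rewrite paddr_eq0 ?sqr_ge0 // !sqrf_eq0 => /andP[/eqP E0 /eqP E1].
by apply/eqP/row2P; rewrite mxE.
Qed.

Lemma vec2_to_circle x : vec2 (to_circle x) = (enorm x)^-1 *: x.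
Proof. by apply: row2P; rewrite vec2E mxE mulrC. Qed.

Lemma gauge1_neq0 x : gauge x = 1 -> x != 0.
Proof. by move=> x1; apply/eqP => x0; move: x1; rewrite x0 gauge0; lra. Qed.

Lemma circle_neq0 (p : R * R) : circle p -> vec2 p != 0.
Proof.
rewrite /circle /= => pc; apply/eqP => p0.
have := congr1 (fun x : 'rV_2 => x 0 0) p0; have := congr1 (fun x : 'rV_2 => x 0 1) p0.
by rewrite !vec2E !mxE => p2 p1; move: pc; rewrite p1 p2; lra.
Qed.

Lemma to_circleP x : x != 0 -> circle (to_circle x).
Proof.
move=> x0; have e0 := enorm_gt0 x0.
have e2 : enorm x ^+ 2 = x 0 0 ^+ 2 + x 0 1 ^+ 2.
  by rewrite sqr_sqrtr // addr_ge0 ?sqr_ge0.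
by rewrite /circle /= !exprMn -mulrDl -e2 -exprMn divff ?expr1n // gt_eqF.
Qed.

Lemma to_polygonP p : vec2 p != 0 -> gauge (to_polygon p) = 1.
Proof.
move=> /gauge_gt0 p0.
by rewrite gaugeZ ?invr_ge0 ?ltW // mulVf // gt_eqF.
Qed.

Lemma to_circleK x : gauge x = 1 -> to_polygon (to_circle x) = x.
Proof.
move=> x1; have e0 := enorm_gt0 (gauge1_neq0 x1).
rewrite /to_polygon vec2_to_circle gaugeZ ?invr_ge0 ?ltW // x1 mulr1 invrK.
by rewrite scalerA divff ?scale1r // gt_eqF.
Qed.

Lemma to_polygonK p : circle p -> to_circle (to_polygon p) = p.
Proof.
move=> pc; have g0 := gauge_gt0 (circle_neq0 pc).
have E : enorm (to_polygon p) = (gauge (vec2 p))^-1.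
  rewrite /enorm !mxE !exprMn -mulrDr pc mulr1 sqrtr_sqr ger0_norm //.
  by rewrite invr_ge0 ltW.
rewrite /to_circle E /to_polygon !mxE /= invrK.
by case: p pc g0 E => a b /= _ g0 _; rewrite ![_ * _ * gauge _]mulrAC !mulVf ?mul1r // gt_eqF.
Qed.

Lemma coordM_continuous (j : 'I_2) (f : 'rV[R]_2 -> R) x : {for x, continuous f} ->
  {for x, continuous (fun y : 'rV[R]_2 => y 0 j * f y)}.
Proof.
move=> cf; apply: (@continuousM R 'rV[R]_2 (fun y => y 0 j) f) => //.
exact: coord_continuous.
Qed.

Lemma to_circle_continuous x : x != 0 -> {for x, continuous to_circle}.
Proof.
move=> x0; have e0 := enorm_gt0 x0.
have sq (j : 'I_2) : continuous (fun y : 'rV[R]_2 => y 0 j ^+ 2).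
  by move=> y; apply: coordM_continuous; exact: coord_continuous.
have ce : continuous enorm.
  move=> y; apply: (@continuous_comp _ _ _
    (fun y : 'rV[R]_2 => y 0 0 ^+ 2 + y 0 1 ^+ 2) Num.sqrt).
    apply: (@continuousD _ R^o 'rV[R]_2 (fun y => y 0 0 ^+ 2)
      (fun y => y 0 1 ^+ 2)); exact: sq.
  exact: sqrt_continuous.
have cV : {for x, continuous (fun y => (enorm y)^-1)}.
  by apply: (@continuousV R 'rV[R]_2 enorm x); [rewrite gt_eqF|exact: ce].
have c (j : 'I_2) := coordM_continuous (j := j) cV.
exact: (cvg_pair (c 0) (c 1)).
Qed.

Lemma to_polygon_continuous p : vec2 p != 0 -> {for p, continuous to_polygon}.
Proof.
move=> p0; have g0 := gauge_gt0 p0.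
have cv : continuous (@vec2 R).
  move=> q; apply: continuous_row => /= j; case: (unliftP 0 j) => [l|] ->.
    rewrite (_ : (fun u => _) = snd); first exact: cvg_snd.
    by apply/funext => u; rewrite mxE.
  rewrite (_ : (fun u => _) = fst); first exact: cvg_fst.
  by apply/funext => u; rewrite mxE.
apply: (@continuous_comp _ _ _ (@vec2 R) (fun x => (gauge x)^-1 *: x)); first exact: cv.
apply: (@continuousZ R 'rV[R]_2 'rV[R]_2 (fun x => (gauge x)^-1) (fun x => x)).
  apply: (@continuousV R 'rV[R]_2 gauge); [by rewrite gt_eqF|exact: gauge_continuous].
exact: cvg_id.
Qed.

End Polygon.

(** * The polyhedral torus in 4-space *)

Section Realization.
Variables (R : realType) (n k : nat).
Hypotheses (n_gt2 : (2 < n)%N) (k_gt2 : (2 < k)%N).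
Local Notation V := ('Z_n * 'Z_k)%type.
Local Notation K := (torus_quad n k).

(** The dimension is written 2 + 2 for the block matrix operations, and is
    convertible to 4. *)
Definition duoprism_vertex (v : V) : 'rV[R]_(2 + 2) := row_mx (corner R v.1) (corner R v.2).
Local Notation f := (duoprism_vertex : V -> 'rV[R]_4).

(** The sum of linear forms exposing the two arcs exposes their product. *)
Lemma cell_exposed c : c \in cells K -> exposed f c.
Proof.
case/cellP=> a [i [b [j ->]]].
have [m [s ms]] := @arc_exposed R n n_gt2 a i.
have [m' [s' ms']] := @arc_exposed R k k_gt2 b j.
exists (col_mx m^T m'^T), (s + s') => v.
have -> : (f v *m col_mx m^T m'^T) 0 0 = dot (corner R v.1) m + dot (corner R v.2) m'.
  by rewrite /duoprism_vertex (mul_row_col (corner R v.1)) mxE.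
rewrite in_box; split=> [/andP[v1 v2]|].
  by rewrite (ms _).1 // (ms' _).1.
have le1 : dot (corner R v.1) m <= s.
  by have [/(ms _).1->//|/(ms _).2/ltW] := boolP (v.1 \in arc a i).
have le2 : dot (corner R v.2) m' <= s'.
  by have [/(ms' _).1->//|/(ms' _).2/ltW] := boolP (v.2 \in arc b j).
rewrite negb_and => /orP[/(ms _).2|/(ms' _).2] lt; first exact: ltr_leD.
exact: ler_ltD.
Qed.

Lemma duoprism_inj : injective f.
Proof.
move=> [i j] [i' j'] E; have [E1 E2] := @eq_row_mx R 1 2 2 _ _ _ _ E.
by congr pair; [exact: corner_inj n_gt2 _ _ E1|exact: corner_inj k_gt2 _ _ E2].
Qed.

Lemma duoprism_meet c1 c2 : c1 \in cells K -> c2 \in cells K ->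
  hull f c1 `&` hull f c2 `<=`
  \bigcup_(c in [set c | [/\ c \in cells K, c \subset c1 & c \subset c2]]) hull f c.
Proof.
move=> c1K c2K x [x1 x2]; exists (c1 :&: c2)%SET; last first.
  exact: exposed_hullI (cell_exposed c2K) x1 x2.
have [v /setIP[v1 v2]] := hull_neq0 (exposed_hullI (cell_exposed c2K) x1 x2).
by split; [exact: (cellI c1K c2K v1 v2)|exact: finset.subsetIl|exact: finset.subsetIr].
Qed.

Lemma duoprism_planar F : F \in faces K -> coplanar f F.
Proof.
case/faceP=> i [j ->].
pose u := corner R (i + 1) - corner R i; pose v := corner R (j + 1) - corner R j.
have u0 : u != 0.
  by rewrite subr_eq0 (inj_eq (corner_inj n_gt2)) succE.
exists (f (i, j)), (block_mx u 0 0 v : 'M[R]_(1 + 1, 2 + 2)); split.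
  rewrite /row_free (rank_diag_block_mx u v) !rank_rV u0.
  by rewrite subr_eq0 (inj_eq (corner_inj k_gt2)) succE.
move=> p; rewrite in_box !in_arc /= => /andP[p1 p2].
have seg m (x y : 'Z_m) : (x == y) || (x == y + 1) -> exists c : R,
   corner R x - corner R y = c%:M *m (corner R (y + 1) - corner R y).
  case/orP=> /eqP->; [exists 0|exists 1]; first by rewrite subrr raddf0 mul0mx.
  by rewrite mul1mx.
have [c cE] := seg _ _ _ p1; have [c' cE'] := seg _ _ _ p2.
apply/submxP; exists (row_mx c%:M c'%:M : 'M[R]_(1, 1 + 1)).
rewrite (mul_row_block c%:M c'%:M u) !mulmx0 addr0 add0r -cE -cE'.
have sub (x y z t : 'rV[R]_2) :
    row_mx x y - row_mx z t = row_mx (x - z) (y - t) :> 'rV_(2 + 2).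
  by rewrite opp_row_mx add_row_mx.
exact: sub.
Qed.

Lemma matrix_isometry d (M : 'M[R]_d) : M *m M^T = 1%:M ->
  euclidean_isometry (mulmxr M : 'rV[R]_d -> 'rV[R]_d).
Proof.
move=> MM x y.
have E (z t : 'rV[R]_d) : euclidean_dist z t = Num.sqrt (((z - t) *m (z - t)^T) 0 0).
  congr Num.sqrt; rewrite mxE; apply: eq_bigr => i _.
  by rewrite !mxE expr2.
rewrite !E /= -mulmxBl trmx_mul mulmxA -[_ *m M *m _]mulmxA MM mulmx1 //.
Qed.

Lemma polyhedron_image (s : {perm V}) (M : 'M[R]_4) x : s \in complex_aut K ->
  (forall v, f v *m M = f (s v)) -> polyhedron K f x -> polyhedron K f (x *m M).
Proof.
move=> sK sM [c /= cK [w [w0 w1 ->]]]; exists (s @: c)%SET; first exact: aut_cell.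
have si : {in c &, injective s} by move=> u v _ _; exact: perm_inj.
exists (fun v => w (s^-1%g v)); split.
- by move=> _ /imsetP[v vc ->]; rewrite permK w0.
- by rewrite big_imset //=; under eq_bigr do rewrite permK.
rewrite big_imset //= mulmx_suml; apply: eq_bigr => v _.
by rewrite permK -scalemxAl sM.
Qed.

(** An orthogonal matrix that permutes the vertices by an automorphism maps the
    polyhedron into itself; the transpose does so for the inverse automorphism,
    so the image is the whole polyhedron. *)
Lemma matrix_symmetry (s : {perm V}) (M : 'M[R]_4) : s \in complex_aut K ->
  M *m M^T = 1%:M -> (forall v, f v *m M = f (s v)) ->
  exists T : 'rV[R]_4 -> 'rV[R]_4,
    [/\ euclidean_isometry T, T @` polyhedron K f = polyhedron K f &
        forall v, T (f v) = f (s v)].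
Proof.
move=> sK MM sM; exists (mulmxr M); split=> //; first exact: matrix_isometry.
apply/seteqP; split=> [_ [x xP <-]|x xP]; first exact: polyhedron_image sK sM xP.
exists (x *m M^T); last by rewrite /= -mulmxA (mulmx1C MM) mulmx1.
apply: (polyhedron_image (groupVr sK)) xP => v.
by rewrite -{1}[v](permKV s) -sM -mulmxA MM mulmx1.
Qed.

Lemma block_orthogonal (A B : 'M[R]_2) : A *m A^T = 1%:M -> B *m B^T = 1%:M ->
  (block_mx A 0 0 B *m (block_mx A 0 0 B)^T = 1%:M) /\
  (block_mx 0 A B 0 *m (block_mx 0 A B 0)^T = 1%:M).
Proof.
move=> AA' BB'; split; rewrite tr_block_mx mulmx_block !trmx0 !mulmx0 !mul0mx;
  by rewrite !(addr0, add0r) AA' BB' -scalar_mx_block.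
Qed.

Lemma duoprism_dihedral t t' (a b : bool) i j :
  f (i, j) *m block_mx (plane_isometry (angle R t) a) 0 0 (plane_isometry (angle R t') b) =
  f (dihedral t a i, dihedral t' b j).
Proof.
rewrite /duoprism_vertex (mul_row_block (corner R i)) !mulmx0 addr0 add0r.
by rewrite !corner_plane_isometry.
Qed.

Lemma sum_setX (M : nmodType) (A : {set 'Z_n}) (B : {set 'Z_k}) (g : V -> M) :
  \sum_(v in finset.setX A B) g v = \sum_(i in A) \sum_(j in B) g (i, j).
Proof. by rewrite pair_big /=; apply: eq_big => [[i j]|[i j] _]; rewrite ?finset.in_setX. Qed.

Lemma lsub_duoprism v : lsubmx (duoprism_vertex v) = corner R v.1.
Proof. exact: row_mxKl. Qed.

Lemma rsub_duoprism v : rsubmx (duoprism_vertex v) = corner R v.2.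
Proof. exact: row_mxKr. Qed.

(** The hull of a product is the product of the hulls: marginal weights in one
    direction, product weights in the other. *)
Lemma duoprism_hull a i b j (x : 'rV[R]_(2 + 2)) : hull f (box a i b j) x <->
  hull (@corner R n) (arc a i) (lsubmx x) /\ hull (@corner R k) (arc b j) (rsubmx x).
Proof.
split=> [[w [w0 w1 ->]]|[[w [w0 w1 xE]] [w' [w'0 w'1 xE']]]].
  have wp i' j' : i' \in arc a i -> j' \in arc b j -> 0 <= w (i', j').
    by move=> ia jb; rewrite w0 // in_box ia.
  rewrite sum_setX in w1; rewrite sum_setX.
  split.
    exists (fun i' => \sum_(j' in arc b j) w (i', j')); split=> //.
      by move=> i' ia; apply: sumr_ge0 => j' jb; exact: wp.
    rewrite linear_sum; apply: eq_bigr => i' _; rewrite linear_sum scaler_suml.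
    by apply: eq_bigr => j' _; rewrite linearZ /= lsub_duoprism.
  exists (fun j' => \sum_(i' in arc a i) w (i', j')); split=> //.
  - by move=> j' jb; apply: sumr_ge0 => i' ia; exact: wp.
  - by rewrite exchange_big.
  rewrite exchange_big linear_sum; apply: eq_bigr => j' _; rewrite linear_sum scaler_suml.
  by apply: eq_bigr => i' _; rewrite linearZ /= rsub_duoprism.
exists (fun v => w v.1 * w' v.2); split.
- by move=> v; rewrite in_box => /andP[/w0 ? /w'0 ?]; exact: mulr_ge0.
- by rewrite sum_setX -w1; apply: eq_bigr => i' _; rewrite /= -mulr_sumr w'1 mulr1.
have ext (y z : 'rV[R]_(2 + 2)) : lsubmx y = lsubmx z -> rsubmx y = rsubmx z -> y = z.
  by move=> yl yr; rewrite -[y]hsubmxK yl yr hsubmxK.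
rewrite sum_setX; apply: ext; rewrite ?xE ?xE'.
  rewrite linear_sum; apply: eq_bigr => i' _; rewrite linear_sum /=.
  under [RHS]eq_bigr do rewrite linearZ /= lsub_duoprism mulrC -scalerA /=.
  by rewrite -scaler_suml w'1 scale1r.
rewrite exchange_big linear_sum; apply: eq_bigr => j' _; rewrite linear_sum /=.
under [RHS]eq_bigr do rewrite linearZ /= rsub_duoprism -scalerA /=.
by rewrite -scaler_suml w1 scale1r.
Qed.

Lemma duoprism_polyhedron (x : 'rV[R]_(2 + 2)) : polyhedron K f x <->
  gauge n (lsubmx x) = 1 /\ gauge k (rsubmx x) = 1.
Proof.
split=> [[c /= /cellP[a [i [b [j ->]]]] /duoprism_hull[x1 x2]]|[]].
  by split; apply/gauge_boundary => //; [exists a, i|exists b, j].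
move=> /(gauge_boundary n_gt2)[a [i x1]] /(gauge_boundary k_gt2)[b [j x2]].
exists (box a i b j); first by apply/cellP; exists a, i, b, j.
exact/duoprism_hull.
Qed.

Lemma duoprism_toroidal : toroidal K f.
Proof.
pose g (x : 'rV[R]_(2 + 2)) := (to_circle (lsubmx x), to_circle (rsubmx x)).
pose h (p : (R * R) * (R * R)) : 'rV[R]_(2 + 2) :=
  row_mx (to_polygon n p.1) (to_polygon k p.2).
have lsub_cont : continuous (lsubmx : 'rV[R]_(2 + 2) -> 'rV[R]_2).
  move=> x; apply: continuous_row => j.
  rewrite (_ : (fun u => lsubmx u 0 j) =
    (fun u : 'rV[R]_(2 + 2) => u 0 (lshift 2 j))); first exact: coord_continuous.
  by apply/funext => u; rewrite mxE.
have rsub_cont : continuous (rsubmx : 'rV[R]_(2 + 2) -> 'rV[R]_2).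
  move=> x; apply: continuous_row => j.
  rewrite (_ : (fun u => rsubmx u 0 j) =
    (fun u : 'rV[R]_(2 + 2) => u 0 (rshift 2 j))); first exact: coord_continuous.
  by apply/funext => u; rewrite mxE.
exists g, h; split.
- apply: continuous_in_subspaceT => x; rewrite inE => /duoprism_polyhedron[x1 x2].
  have c1 : {for x, continuous (fun y : 'rV[R]_(2 + 2) => to_circle (lsubmx y))}.
    apply: (@continuous_comp _ _ _ lsubmx (@to_circle R)); first exact: lsub_cont.
    exact: to_circle_continuous (gauge1_neq0 n_gt2 x1).
  have c2 : {for x, continuous (fun y : 'rV[R]_(2 + 2) => to_circle (rsubmx y))}.
    apply: (@continuous_comp _ _ _ rsubmx (@to_circle R)); first exact: rsub_cont.
    exact: to_circle_continuous (gauge1_neq0 k_gt2 x2).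
  exact: (cvg_pair c1 c2).
- apply: continuous_in_subspaceT => p; rewrite inE => -[/circle_neq0 p1 /circle_neq0 p2].
  have c1 : {for p, continuous (fun q : (R * R) * (R * R) => to_polygon n q.1)}.
    apply: (@continuous_comp _ _ _ fst (to_polygon n)); first exact: cvg_fst.
    exact: to_polygon_continuous.
  have c2 : {for p, continuous (fun q : (R * R) * (R * R) => to_polygon k q.2)}.
    apply: (@continuous_comp _ _ _ snd (to_polygon k)); first exact: cvg_snd.
    exact: to_polygon_continuous.
  apply: (@continuous_row _ _ (2 + 2)) => j; rewrite -(@splitK 2 2 j).
  case: (@fintype.split 2 2 j) => l /=.
    rewrite (_ : (fun u => h u 0 (lshift 2 l)) = (fun u => to_polygon n u.1 0 l)); last first.
      by apply/funext => u; rewrite row_mxEl.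
    apply: (@continuous_comp _ _ _ _ (fun x : 'rV[R]_2 => x 0 l)); first exact: c1.
    exact: coord_continuous.
  rewrite (_ : (fun u => h u 0 (rshift 2 l)) = (fun u => to_polygon k u.2 0 l)); last first.
    by apply/funext => u; rewrite row_mxEr.
  apply: (@continuous_comp _ _ _ _ (fun x : 'rV[R]_2 => x 0 l)); first exact: c2.
  exact: coord_continuous.
- move=> _ [x /duoprism_polyhedron[x1 x2] <-]; split.
    exact: to_circleP (gauge1_neq0 n_gt2 x1).
  exact: to_circleP (gauge1_neq0 k_gt2 x2).
- move=> _ [p [p1 p2] <-]; apply/duoprism_polyhedron; rewrite row_mxKl row_mxKr.
  by split; apply: to_polygonP => //; exact: circle_neq0.
split=> [x|p]; rewrite inE.
  move=> /duoprism_polyhedron[x1 x2].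
  by rewrite /h /g /= !to_circleK // hsubmxK.
case: p => p q [/= p1 p2].
by rewrite /h /g row_mxKl row_mxKr !to_polygonK.
Qed.

Lemma duoprism_realization : geometric_realization K f.
Proof.
split.
- exact: duoprism_inj.
- exact: duoprism_planar.
- by move=> e F eK _ _; apply: exposed_side; apply: cell_exposed; exact: edge_cell.
- exact: duoprism_meet.
Qed.

End Realization.

Lemma duoprism_swap (R : realType) n (n_gt2 : (2 < n)%N) (t t' i j : 'Z_n) a b :
  duoprism_vertex R (i, j) *m block_mx 0 (plane_isometry (angle R t') b)
                                       (plane_isometry (angle R t) a) 0 =
  duoprism_vertex R (dihedral t a j, dihedral t' b i).
Proof.
rewrite /duoprism_vertex (mul_row_block (corner R i)) !mulmx0 addr0 add0r.
by rewrite !corner_plane_isometry.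
Qed.

Lemma duoprism_symmetries (R : realType) (n k : nat) : (2 < n)%N -> (2 < k)%N ->
  without_hidden_symmetries (torus_quad n k)
    (duoprism_vertex R (n := n) (k := k) : _ -> 'rV[R]_4).
Proof.
move=> n_gt2 k_gt2 s sK.
case: (aut_classification n_gt2 k_gt2 sK) => -[t [t' [a [b sE]]]].
  have [MM _] := block_orthogonal (plane_isometry_orthogonal (angle R t) a)
    (plane_isometry_orthogonal (angle R t') b).
  by apply: (matrix_symmetry sK MM) => -[i j]; rewrite sE; apply: duoprism_dihedral.
have nk := swapping_aut_eq n_gt2 k_gt2 sE; subst k.
have [_ MM] := block_orthogonal (plane_isometry_orthogonal (angle R t') b)
  (plane_isometry_orthogonal (angle R t) a).
apply: (matrix_symmetry sK MM) => -[i j].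
have -> : s (i, j) = (dihedral t a j, dihedral t' b i).
  rewrite -{1}[i]natr_Zp -{1}[j]natr_Zp sE -[_ *+ i]mulr_natr -[_ *+ j]mulr_natr.
  by rewrite !natr_Zp.
exact: duoprism_swap.
Qed.

Theorem corollary3 (R : realType) :
  (forall n k : nat, (3 <= n)%N -> (3 <= k)%N ->
     exists f : 'Z_n * 'Z_k -> 'rV[R]_4,
       noble_polyhedron (torus_quad n k) f /\ toroidal (torus_quad n k) f) /\
  (forall n : nat, (3 <= n)%N ->
     exists f : 'Z_n * 'Z_n -> 'rV[R]_4,
       regular_polyhedron (torus_quad n n) f /\ toroidal (torus_quad n n) f).
Proof.
split=> [n k n_gt2 k_gt2|n n_gt2].
  exists (@duoprism_vertex R n k); split; last exact: duoprism_toroidal.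
  split; [exact: torus_surface|exact: duoprism_realization|exact: duoprism_symmetries| |].
    exact: torus_vertex_transitive.
  exact: torus_face_transitive.
exists (@duoprism_vertex R n n); split; last exact: duoprism_toroidal.
split; [exact: torus_surface|exact: duoprism_realization|exact: duoprism_symmetries|].
exact: torus_flag_transitive.
Qed.
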